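(* Let $\beta_0>\beta_1>\beta_2>\cdots$ be the zeros of $\psi_G$ (the logarithmic derivative of the Barnes $G$ function), and let $L=\log(2\pi)$. Then $$\begin{aligned}\sum_{k=0}^\infty\frac{1}{\beta_k^4}={}&2\zeta(3)(L+1)+\gamma^4+\frac{\pi^4}{9}+\frac16\pi^2\left(L^2+3\right)+2\gamma^3(L+1)\\&+\frac16\gamma\left[24\zeta(3)+3+4\pi^2(L+1)+3L(L^2-L+7)\right]\\&+\frac16\gamma^2\left[9L^2+6L+4\pi^2+21\right]+\frac1{16}\left[L^4-4L^3+22L^2-36L+49\right],\end{aligned}$$ where $\gamma$ is the Euler constant and $\zeta$ is the Riemann zeta function.
   Context: $\Gamma$ is the Euler gamma function and $\psi=\Gamma'/\Gamma$ is the Digamma function. The Barnes $G$ function satisfies $G(z+1)=\Gamma(z)G(z)$ with $G(1)=1$, and its logarithmic derivative is $$\psi_G(z)=\frac{G'(z)}{G(z)}=\frac{\log(2\pi)+1}{2}-z+(z-1)\psi(z)\quad(z\in\mathbb C\setminus\{0,-1,-2,\dots\}).$$ The function $\psi_G$ has first order poles at the non-positive integers; its zeros are real of multiplicity one, and exactly two of them are positive. They are enumerated in decreasing order: $\beta_0=2.55766\dots$, $\beta_1=1.39147\dots$, $\beta_2=-0.3662934\dots$, and so on. *)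

(* Defs.v *)
From Stdlib Require Import Reals.
From Coquelicot Require Import Coquelicot.

Open Scope R_scope.

Definition euler_gamma : R :=
  real (Lim_seq (fun n => sum_n (fun k => / INR (S k)) n - ln (INR (S n)))).

(** The Riemann zeta function on the half-line [s > 1], where its Dirichlet
    series converges. *)
Definition zeta (s : R) : R := Series (fun n => / Rpower (INR (S n)) s).

Definition Cexp (z : C) : C :=
  (exp (Re z) * cos (Im z), exp (Re z) * sin (Im z)).

Definition CLim_seq (u : nat -> C) : C :=
  (real (Lim_seq (fun n => Re (u n))), real (Lim_seq (fun n => Im (u n)))).

Fixpoint Cprod (a : nat -> C) (n : nat) : C :=
  match n with
  | O => RtoC 1
  | S m => Cmult (Cprod a m) (a m)
  end.

Open Scope C_scope.

(** The recurrence [G(z+1) = Gamma(z) G(z)], [G(1) = 1] has many solutions;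
    the Barnes function is singled out by its Weierstrass product
    [G(1+w) = (2 pi)^(w/2) exp(-(w + w^2 (1 + gamma)) / 2)
              * prod_(k >= 1) (1 + w/k)^k exp(w^2/(2k) - w)],
    which converges on the whole complex plane.  Here [k = S m], [w = z - 1]. *)
Definition barnes_factor (w : C) (m : nat) : C :=
  let k := RtoC (INR (S m)) in
  Cpow (1 + w / k) (S m) * Cexp (w * w / (2 * k) - w).

Definition barnesG (z : C) : C :=
  let w := z - 1 in
  Cexp (w / 2 * RtoC (ln (2 * PI)))
  * Cexp (- ((w + w * w * (1 + RtoC euler_gamma)) / 2))
  * CLim_seq (Cprod (barnes_factor w)).

(** Meaningful off the non-positive integers, which are the zeros of
    [barnesG].  [C_derive] takes the limit of difference quotients along real
    increments, which for the entire function [barnesG] is its complex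
    derivative. *)
Definition psi_G (z : C) : C := C_derive barnesG z / barnesG z.

Definition nonpos_int (z : C) : Prop := exists n : nat, z = RtoC (- INR n).

Definition is_zero_psi_G (z : C) : Prop := ~ nonpos_int z /\ psi_G z = 0.

Close Scope C_scope.

(* Main.v *)
Require Import Defs.
From Stdlib Require Import Reals Lra Lia ClassicalEpsilon.
From Coquelicot Require Import Coquelicot.
Open Scope R_scope.

(** On the real line [psi_G (w + 1) = a - b w + w^2 sum_(k >= 1) 1 / (k (k + w))]
    with [a = (L - 1) / 2] and [b = 1 + gamma].  Truncating the sum at [N] poles
    gives a rational function whose numerator has degree [N + 1] and changes sign
    between consecutive poles ([N - 1] times) and on [(0, 1)] and [(1, 8)]; so all
    its roots are real, simple and located.  Newton's formula expresses the sum
    of their inverse fourth powers (in [z = w + 1]) through the Taylor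
    coefficients at [z = 0].  As [N] grows each root converges to the only zero
    of [psi_G] in its interval, and Tannery's theorem gives the series.  The same
    power sums, applied to [sin ((2 m + 1) x) / sin x] as a polynomial in
    [sin^2 x], give the values of zeta at 2 and 4. *)

(** * Finite sums and limits *)

(** The hypothesis on [beta] places every zero on the real line, so all of the analysis is real.
    Factoring the transcendental function [psi_G] over its zeros would call for growth estimates; a
    truncation is rational, and once as many roots are located as its numerator has degree, no other
    root is left to account for. Locating the roots and passing to the limit need the same sign
    information for the truncations and for [psi_G], so both are instances of one function [wpsi]
    with weights between 0 and 1. Three inequalities carry the location: [0 < a] makes [wpsi]
    positive on [(-1, 0]], [a < b - 1] makes it negative at [w = 1], and [b <= 2] keeps it positive
    from [w = 8] on. They follow from [1 < L < 2] and [1/2 <= gamma <= 1]. The values of zeta at 2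
    and 4 enter because the Taylor coefficients at [z = 0] and the sum over the poles contain the
    sums of [1/k^2] and [1/k^4]. *)

Fixpoint psum (u : nat -> R) (n : nat) : R :=
  match n with
  | O => 0
  | S m => psum u m + u m
  end.

Lemma sum_n_psum u n : sum_n u n = psum u (S n).
Proof.
  induction n as [|n IH].
  - rewrite sum_O; simpl; lra.
  - rewrite sum_Sn, IH; reflexivity.
Qed.

Lemma psum_ext u v n :
  (forall k, (k < n)%nat -> u k = v k) -> psum u n = psum v n.
Proof.
  induction n as [|n IH]; simpl; intros H; [reflexivity|].
  rewrite IH by (intros; apply H; lia); rewrite H by lia; reflexivity.
Qed.

Lemma psum_le u v n :
  (forall k, (k < n)%nat -> u k <= v k) -> psum u n <= psum v n.
Proof.
  induction n as [|n IH]; simpl; intros H; [lra|].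
  apply Rplus_le_compat; [apply IH; intros; apply H; lia | apply H; lia].
Qed.

Lemma psum_plus u v n : psum (fun k => u k + v k) n = psum u n + psum v n.
Proof. induction n as [|n IH]; simpl; [|rewrite IH]; ring. Qed.

Lemma psum_scal c u n : psum (fun k => c * u k) n = c * psum u n.
Proof. induction n as [|n IH]; simpl; [|rewrite IH]; ring. Qed.

Lemma psum_tail_le u M n m :
  (forall k, (n <= k < m)%nat -> Rabs (u k) <= M k) -> (n <= m)%nat ->
  Rabs (psum u m - psum u n) <= psum M m - psum M n.
Proof.
  intros H Hnm; induction Hnm as [|m Hnm IH].
  - rewrite !Rminus_diag, Rabs_R0; lra.
  - simpl; replace (psum u m + u m - psum u n) with (psum u m - psum u n + u m) by ring.
    eapply Rle_trans; [apply Rabs_triang|].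
    specialize (IH ltac:(intros; apply H; lia)).
    specialize (H m ltac:(lia)); lra.
Qed.

Lemma is_series_psum u l : is_series u l <-> is_lim_seq (psum u) l.
Proof.
  rewrite (is_lim_seq_incr_1 (psum u)).
  change (is_series u l) with (is_lim_seq (sum_n u) l).
  split; apply is_lim_seq_ext; intros n; rewrite sum_n_psum; reflexivity.
Qed.

Lemma psum_le_Series M n :
  (forall k, 0 <= M k) -> ex_series M -> psum M n <= Series M.
Proof.
  intros Hp HM.
  apply Series_correct, is_series_psum in HM.
  apply (is_lim_seq_incr_compare _ _ HM).
  intros m; simpl; specialize (Hp m); lra.
Qed.

Lemma is_lim_seq_psum (u : nat -> nat -> R) (v : nat -> R) n :
  (forall k, (k < n)%nat -> is_lim_seq (fun N => u N k) (v k)) ->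
  is_lim_seq (fun N => psum (u N) n) (psum v n).
Proof.
  induction n as [|n IH]; simpl; intros H.
  - apply is_lim_seq_const.
  - apply is_lim_seq_plus'; [apply IH; intros; apply H; lia | apply H; lia].
Qed.

(** Past an index [K] both sums are within the tail of [M], uniformly in [N]; below [K] only
    finitely many terms have to converge. The length [len N] varies because the number of roots
    grows with [N]. *)
Lemma tannery (u : nat -> nat -> R) (v M : nat -> R) (len : nat -> nat) (l : R) :
  (forall k, is_lim_seq (fun N => u N k) (v k)) ->
  ex_series M ->
  eventually (fun N => forall k, (k < len N)%nat -> Rabs (u N k) <= M k) ->
  (forall K, eventually (fun N => (K <= len N)%nat)) ->
  is_lim_seq (fun N => psum (u N) (len N)) l ->
  is_series v l.
Proof.
  intros Hlim HM [N0 Hdom] Hlen Hl.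
  (* The bound passes to the limit, since each [k] is eventually below [len N]. *)
  assert (Hv : forall k, Rabs (v k) <= M k).
  { intros k; destruct (Hlen (S k)) as [N1 HN1].
    apply (is_lim_seq_le_loc (fun N => Rabs (u N k)) (fun _ => M k)
             (Rabs (v k)) (M k)).
    - exists (N0 + N1)%nat; intros N HN.
      apply (Hdom N ltac:(lia) k); specialize (HN1 N ltac:(lia)); lia.
    - apply (is_lim_seq_abs _ (v k)), Hlim.
    - apply is_lim_seq_const. }
  assert (HMp : forall k, 0 <= M k).
  { intros k; eapply Rle_trans; [apply Rabs_pos|apply Hv]. }
  assert (Ev : ex_series v).
  { apply (ex_series_le v M); [exact Hv|exact HM]. }
  pose proof (proj1 (is_series_psum _ _) (Series_correct _ Ev)) as Sv.
  pose proof (proj1 (is_series_psum _ _) (Series_correct _ HM)) as SM.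
  assert (HS : is_lim_seq (fun N => psum (u N) (len N)) (Series v)).
  { apply is_lim_seq_spec; intros eps.
    assert (He : 0 < eps / 4) by (destruct eps; simpl; lra).
    apply is_lim_seq_spec in SM; destruct (SM (mkposreal _ He)) as [K1 HK1].
    apply is_lim_seq_spec in Sv; destruct (Sv (mkposreal _ He)) as [K2 HK2].
    simpl in HK1, HK2.
    set (K := (K1 + K2)%nat).
    specialize (HK1 K ltac:(lia)); specialize (HK2 K ltac:(lia)).
    assert (HK : is_lim_seq (fun N => psum (u N) K) (psum v K)).
    { apply is_lim_seq_psum; auto. }
    apply is_lim_seq_spec in HK; destruct (HK (mkposreal _ He)) as [N1 HN1].
    simpl in HN1.
    destruct (Hlen K) as [N2 HN2].
    exists (N0 + N1 + N2)%nat; intros N HN.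
    specialize (HN1 N ltac:(lia)); specialize (HN2 N ltac:(lia)).
    pose proof (psum_tail_le (u N) M K (len N)
      ltac:(intros; apply Hdom; lia) HN2) as T.
    pose proof (psum_le_Series M (len N) HMp HM).
    revert HK1 HK2 HN1 T.
    unfold Rabs; repeat destruct Rcase_abs; lra. }
  pose proof (is_lim_seq_unique _ _ HS) as U1.
  pose proof (is_lim_seq_unique _ _ Hl) as U2.
  rewrite U1 in U2; injection U2 as <-.
  apply Series_correct, Ev.
Qed.

(** * Power sums of the roots of a polynomial *)

Definition peval (a : nat -> R) (n : nat) (x : R) : R :=
  psum (fun i => a i * x ^ i) (S n).

Lemma peval_S a n x : peval a (S n) x = peval a n x + a (S n) * x ^ S n.
Proof. reflexivity. Qed.

Fixpoint quot_coef (a : nat -> R) (y : R) (i : nat) : R :=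
  match i with
  | O => a O
  | S j => a (S j) + y * quot_coef a y j
  end.

(* [quot_coef a (/ r)] is the power series quotient of [a] by [1 - x / r];
   it is a polynomial exactly when [r] is a root. *)
Lemma peval_quot_coef a y n x :
  peval a (S n) x =
  (1 - y * x) * peval (quot_coef a y) n x + quot_coef a y (S n) * x ^ S n.
Proof.
  induction n as [|n IH].
  - unfold peval; simpl; ring.
  - rewrite (peval_S a (S n)), IH, (peval_S _ n x).
    simpl (quot_coef a y (S (S n))); simpl; ring.
Qed.

(** At [x = r] the factor [1 - x / r] vanishes, so the remainder coefficient in [peval_quot_coef]
    must vanish too; the recursion then carries this zero upwards. *)
Lemma quot_coef_root a n r :
  r <> 0 -> (forall i, (S n < i)%nat -> a i = 0) -> peval a (S n) r = 0 ->
  forall i, (n < i)%nat -> quot_coef a (/ r) i = 0.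
Proof.
  intros Hr Ha H0 i Hi.
  assert (H1 : quot_coef a (/ r) (S n) = 0).
  { rewrite (peval_quot_coef a (/ r)) in H0.
    rewrite Rinv_l, Rminus_diag, Rmult_0_l, Rplus_0_l in H0 by exact Hr.
    apply Rmult_integral in H0; destruct H0 as [H0|H0]; [exact H0|].
    exfalso; revert H0; apply pow_nonzero, Hr. }
  induction Hi as [|i Hi IH]; [exact H1|].
  simpl; rewrite IH, Ha by lia; ring.
Qed.

(** Constant term 1, degree at most [n] and [n] distinct roots force the product of the factors
    [1 - x / r k]. Dividing out one factor lowers the degree, so Newton's identities follow by
    induction on the number of roots. *)
Lemma power_sums n : forall (a r : nat -> R),
  a O = 1 -> (forall i, (n < i)%nat -> a i = 0) ->
  (forall k, (k < n)%nat -> r k <> 0 /\ peval a n (r k) = 0) ->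
  (forall j k, (j < k < n)%nat -> r j <> r k) ->
  psum (fun k => / r k) n = - a 1%nat /\
  psum (fun k => (/ r k) ^ 2) n = a 1%nat ^ 2 - 2 * a 2%nat /\
  psum (fun k => (/ r k) ^ 4) n =
    a 1%nat ^ 4 - 4 * a 1%nat ^ 2 * a 2%nat + 4 * a 1%nat * a 3%nat
    + 2 * a 2%nat ^ 2 - 4 * a 4%nat.
Proof.
  induction n as [|n IH]; intros a r H0 Ha Hr Hd.
  - rewrite !Ha by lia; simpl; repeat split; ring.
  - destruct (Hr n ltac:(lia)) as [Hrn Hroot].
    set (q := quot_coef a (/ r n)).
    destruct (IH q r) as [I1 [I2 I4]].
    + exact H0.
    + apply quot_coef_root; assumption.
    + intros k Hk; destruct (Hr k ltac:(lia)) as [Hk0 Hk1]; split; [exact Hk0|].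
      rewrite (peval_quot_coef a (/ r n)) in Hk1; fold q in Hk1.
      replace (q (S n)) with 0 in Hk1
        by (symmetry; apply (quot_coef_root a n); auto).
      rewrite Rmult_0_l, Rplus_0_r in Hk1.
      apply Rmult_integral in Hk1; destruct Hk1 as [Hk1|Hk1]; [|exact Hk1].
      exfalso; apply (Hd k n ltac:(lia)).
      apply Rminus_diag_uniq_sym in Hk1.
      apply (Rmult_eq_reg_l (/ r n)); [|apply Rinv_neq_0_compat, Hrn].
      rewrite Hk1; field; exact Hrn.
    + intros; apply Hd; lia.
    + cbn [psum]; rewrite I1, I2, I4; unfold q; cbn [quot_coef]; rewrite H0.
      repeat split; ring.
Qed.

Definition shift (a : nat -> R) (i : nat) : R :=
  match i with O => 0 | S j => a j end.

Lemma peval_shift a n x : peval (shift a) (S n) x = x * peval a n x.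
Proof.
  induction n as [|n IH].
  - unfold peval; simpl; ring.
  - rewrite (peval_S (shift a)), IH, (peval_S a); simpl; ring.
Qed.

Lemma peval_plus a b n x :
  peval (fun i => a i + b i) n x = peval a n x + peval b n x.
Proof.
  unfold peval; rewrite <- psum_plus; apply psum_ext; intros; ring.
Qed.

Lemma peval_scal c a n x : peval (fun i => c * a i) n x = c * peval a n x.
Proof.
  unfold peval; rewrite <- psum_scal; apply psum_ext; intros; ring.
Qed.

Lemma peval_widen a n m x :
  (forall i, (n < i)%nat -> a i = 0) -> (n <= m)%nat -> peval a m x = peval a n x.
Proof.
  intros Ha Hm; induction Hm as [|m Hm IH]; [reflexivity|].
  rewrite peval_S, IH, Ha by lia; ring.
Qed.

(** * The values of zeta at 2 and 4 *)

Lemma is_lim_seq_inv_INR_S : is_lim_seq (fun n => / INR (S n)) 0.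
Proof.
  apply is_lim_seq_spec; intros eps; destruct (archimed_cor1 eps) as [N [H1 H2]];
    [apply cond_pos|].
  exists N; intros n Hn; rewrite Rminus_0_r, Rabs_pos_eq.
  - eapply Rle_lt_trans; [|exact H1].
    apply Rinv_le_contravar; [apply lt_0_INR; lia | apply le_INR; lia].
  - left; apply Rinv_0_lt_compat, lt_0_INR; lia.
Qed.

Lemma INR_S_pos n : 0 < INR (S n).
Proof. apply lt_0_INR; lia. Qed.

Lemma INR_S_ge1 n : 1 <= INR (S n).
Proof. change 1 with (INR 1); apply le_INR; lia. Qed.

Lemma is_series_telescope :
  is_series (fun k => / INR (S k) - / INR (S (S k))) 1.
Proof.
  apply is_series_psum.
  apply (is_lim_seq_ext (fun n => 1 - / INR (S n))).
  - intros n; induction n as [|n IH]; [simpl; field|].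
    cbn [psum]; rewrite <- IH; ring.
  - replace (Finite 1) with (Finite (1 - 0)) by (f_equal; ring).
    apply is_lim_seq_minus'; [apply is_lim_seq_const | apply is_lim_seq_inv_INR_S].
Qed.

Lemma ex_series_inv_sq : ex_series (fun k => / INR (S k) ^ 2).
Proof.
  apply (ex_series_le (V := R_CompleteNormedModule) (fun k => / INR (S k) ^ 2)
           (fun k => 2 * (/ INR (S k) - / INR (S (S k))))).
  - intros k; change norm with Rabs; pose proof (INR_S_ge1 k).
    rewrite Rabs_pos_eq by (left; apply Rinv_0_lt_compat; nra).
    rewrite (S_INR (S k)); set (x := INR (S k)) in *.
    apply (Rmult_le_reg_r (x ^ 2 * (x + 1))); [nra|].
    field_simplify; [nra|lra|lra].
  - exists (2 * 1); apply (is_series_scal 2 _ 1), is_series_telescope.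
Qed.

(** The recurrence is [sin (A + 2 x) + sin (A - 2 x) = 2 sin A cos (2 x)] with [A = (2 m + 3) x] and
    [cos (2 x) = 1 - 2 t], where [t = sin^2 x] is the variable of the polynomial. *)
Fixpoint sin_coef (m : nat) : nat -> R :=
  match m with
  | O => fun i => match i with O => 1 | _ => 0 end
  | S m1 =>
    match m1 with
    | O => fun i => match i with O => 3 | S O => -4 | _ => 0 end
    | S m2 => fun i =>
        2 * sin_coef m1 i + (-4 * shift (sin_coef m1) i + -1 * sin_coef m2 i)
    end
  end.

Lemma nat_ind2 (P : nat -> Prop) :
  P O -> P 1%nat -> (forall m, P m -> P (S m) -> P (S (S m))) -> forall m, P m.
Proof.
  intros H0 H1 HS m; cut (P m /\ P (S m)); [tauto|].
  induction m as [|m [IH1 IH2]]; auto.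
Qed.

Lemma sin_coef_deg m i : (m < i)%nat -> sin_coef m i = 0.
Proof.
  revert i; induction m as [| |m IH1 IH2] using nat_ind2; intros i Hi.
  - destruct i; [lia|reflexivity].
  - destruct i as [|[|i]]; [lia|lia|reflexivity].
  - destruct i as [|i]; [lia|].
    change (sin_coef (S (S m)) (S i)) with
      (2 * sin_coef (S m) (S i)
       + (-4 * sin_coef (S m) i + -1 * sin_coef m (S i))).
    rewrite IH1, !IH2 by lia; ring.
Qed.

Lemma sin_odd_multiple m x :
  sin ((2 * INR m + 1) * x) = sin x * peval (sin_coef m) m (sin x ^ 2).
Proof.
  induction m as [| |m IH1 IH2] using nat_ind2.
  - unfold peval; simpl; rewrite Rmult_0_r, Rplus_0_l, !Rmult_1_l; ring.
  - unfold peval; simpl.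
    replace ((2 * 1 + 1) * x) with (2 * x + x) by ring.
    rewrite sin_plus, sin_2a, cos_2a_sin.
    pose proof (sin2_cos2 x) as E; unfold Rsqr in E.
    replace (2 * sin x * cos x * cos x) with (2 * sin x * (1 - sin x * sin x))
      by (rewrite <- E; ring).
    ring.
  - change (sin_coef (S (S m))) with (fun i =>
        2 * sin_coef (S m) i
        + (-4 * shift (sin_coef (S m)) i + -1 * sin_coef m i)).
    rewrite (peval_plus (fun i => 2 * sin_coef (S m) i)).
    rewrite (peval_plus (fun i => -4 * shift (sin_coef (S m)) i)).
    rewrite !peval_scal, peval_shift.
    rewrite (peval_widen (sin_coef (S m)) (S m)) by (auto; apply sin_coef_deg).
    rewrite (peval_widen (sin_coef m) m) by (auto; apply sin_coef_deg).
    set (A := (2 * INR (S m) + 1) * x) in *.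
    replace ((2 * INR (S (S m)) + 1) * x) with (A + 2 * x)
      by (unfold A; rewrite !S_INR; ring).
    replace ((2 * INR m + 1) * x) with (A - 2 * x) in IH1
      by (unfold A; rewrite !S_INR; ring).
    rewrite sin_minus in IH1; rewrite sin_plus.
    rewrite cos_2a_sin in *.
    transitivity (2 * sin A * (1 - 2 * sin x * sin x)
       - sin x * peval (sin_coef m) m (sin x ^ 2)).
    + rewrite <- IH1; ring.
    + rewrite IH2; ring.
Qed.

Lemma sin_coef_low m :
  sin_coef m 0 = 2 * INR m + 1 /\
  sin_coef m 1 = - (2 * INR m + 1) * (2 * INR m * (INR m + 1) / 3) /\
  sin_coef m 2 = (2 * INR m + 1)
    * (2 * INR m * (INR m - 1) * (INR m + 1) * (INR m + 2) / 15).
Proof.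
  induction m as [| |m [A0 [A1 A2]] [B0 [B1 B2]]] using nat_ind2.
  - simpl; repeat split; field.
  - simpl; repeat split; field.
  - change (sin_coef (S (S m))) with (fun i =>
        2 * sin_coef (S m) i
        + (-4 * shift (sin_coef (S m)) i + -1 * sin_coef m i)).
    cbv beta; cbn [shift]; rewrite A0, A1, A2, B0, B1, B2, !S_INR.
    repeat split; field.
Qed.

Definition sin_node (m k : nat) : R := INR (S k) * PI / (2 * INR m + 1).

Lemma two_INR_pos m : 0 < 2 * INR m + 1.
Proof. pose proof (pos_INR m); lra. Qed.

Lemma sin_node_bounds m k : (k < m)%nat -> 0 < sin_node m k < PI / 2.
Proof.
  intros Hk; unfold sin_node; pose proof PI_RGT_0; pose proof (two_INR_pos m).
  pose proof (INR_S_pos k).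
  assert (INR (S k) <= INR m) by (apply le_INR; lia).
  split; [apply Rdiv_lt_0_compat; nra|].
  apply Rlt_div_l; [lra|]; nra.
Qed.

Lemma sin_node_lt m j k : (j < k)%nat -> sin_node m j < sin_node m k.
Proof.
  intros Hk; unfold sin_node; pose proof PI_RGT_0; pose proof (two_INR_pos m).
  apply Rmult_lt_compat_r; [apply Rinv_0_lt_compat; lra|].
  apply Rmult_lt_compat_r; [lra|]; apply lt_INR; lia.
Qed.

(** The nodes are zeros of [sin ((2 m + 1) x)] in [(0, PI / 2)], where [sin^2] is injective and
    nonzero, so they supply all [m] roots of [sin_coef m], which is rescaled to constant term 1. *)
Lemma sin_node_power_sums m :
  psum (fun k => / sin (sin_node m k) ^ 2) m = 2 * INR m * (INR m + 1) / 3 /\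
  psum (fun k => / sin (sin_node m k) ^ 4) m =
    (2 * INR m * (INR m + 1) / 3) ^ 2
    - 4 * INR m * (INR m - 1) * (INR m + 1) * (INR m + 2) / 15.
Proof.
  pose proof (two_INR_pos m) as Hm.
  assert (Hs : forall k, (k < m)%nat -> 0 < sin (sin_node m k)).
  { intros k Hk; pose proof (sin_node_bounds m k Hk); pose proof PI_RGT_0.
    apply sin_gt_0; lra. }
  destruct (sin_coef_low m) as [C0 [C1 C2]].
  destruct (power_sums m (fun i => / (2 * INR m + 1) * sin_coef m i)
              (fun k => sin (sin_node m k) ^ 2)) as [I1 [I2 _]].
  - rewrite C0; field; lra.
  - intros i Hi; rewrite sin_coef_deg by exact Hi; ring.
  - intros k Hk; specialize (Hs k Hk); split; [nra|].
    rewrite peval_scal.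
    assert (E : sin ((2 * INR m + 1) * sin_node m k) = 0).
    { apply sin_eq_0_1; exists (Z.of_nat (S k)); rewrite <- INR_IZR_INZ.
      unfold sin_node; field; lra. }
    rewrite sin_odd_multiple in E; apply Rmult_integral in E.
    destruct E as [E|E]; [lra|]; rewrite E; ring.
  - intros j k Hjk.
    pose proof (sin_node_lt m j k ltac:(lia)).
    pose proof (sin_node_bounds m j ltac:(lia)).
    pose proof (sin_node_bounds m k ltac:(lia)).
    assert (sin (sin_node m j) < sin (sin_node m k)).
    { apply sin_increasing_1; lra. }
    pose proof (Hs j ltac:(lia)); nra.
  - cbv beta in I1, I2; rewrite C1 in I1, I2; rewrite C2 in I2; split.
    + rewrite I1; field; lra.
    + rewrite (psum_ext _ (fun k => (/ sin (sin_node m k) ^ 2) ^ 2)).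
      * rewrite I2; field; lra.
      * intros k Hk; specialize (Hs k Hk); field; lra.
Qed.

Lemma PI_upper : PI < 3.5.
Proof.
  (* Leibniz's series gives [PI / 4 <= 1 - 1/3 + 1/5]. *)
  destruct (PI_ineq 1) as [_ H]; unfold tg_alt, PI_tg in H; simpl in H; lra.
Qed.

Lemma PI_gt_3 : 3 < PI.
Proof. pose proof PI2_3_2; lra. Qed.

(** From [sin x >= x - x^3 / 6], as [x^2 < 3.1] on this range. Since [PI > 3], the slope 1/3 is
    enough for [sin_node_scaled_bound]. *)
Lemma sin_ge_third x : 0 <= x <= PI / 2 -> x / 3 <= sin x.
Proof.
  intros Hx; pose proof PI_upper.
  destruct (pre_sin_bound x 0 ltac:(lra) ltac:(lra)) as [Hs _].
  unfold sin_approx, sin_term in Hs; simpl in Hs.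
  eapply Rle_trans; [|exact Hs].
  enough (x * (x * x) <= x * 3.1) by lra.
  apply Rmult_le_compat_l; nra.
Qed.

Lemma sin_node_scaled_bound m k : (k < m)%nat ->
  INR (S k) <= (2 * INR m + 1) * sin (sin_node m k).
Proof.
  intros Hk; pose proof (sin_node_bounds m k Hk).
  pose proof (sin_ge_third (sin_node m k) ltac:(lra)) as Hs.
  pose proof (two_INR_pos m); pose proof PI_gt_3; pose proof (INR_S_pos k).
  apply (Rmult_le_compat_l (2 * INR m + 1)) in Hs; [|lra].
  eapply Rle_trans; [|exact Hs].
  unfold sin_node; field_simplify; [|lra].
  apply Rle_div_r; nra.
Qed.

Lemma is_lim_seq_inv_two_INR : is_lim_seq (fun m => / (2 * INR m + 1)) 0.
Proof.
  apply (is_lim_seq_le_le (fun _ => 0) _ (fun m => / INR (S m))).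
  - intros m; pose proof (pos_INR m); rewrite S_INR; split.
    + left; apply Rinv_0_lt_compat; lra.
    + apply Rinv_le_contravar; lra.
  - apply is_lim_seq_const.
  - apply is_lim_seq_inv_INR_S.
Qed.

Lemma is_lim_seq_sin_node_scaled k :
  is_lim_seq (fun m => (2 * INR m + 1) * sin (sin_node m k)) (INR (S k) * PI).
Proof.
  set (c := INR (S k) * PI).
  assert (Hc : 0 < c)
    by (pose proof PI_RGT_0; pose proof (INR_S_pos k); unfold c; nra).
  assert (L0 : is_lim_seq (fun m => sin_node m k) 0).
  { replace (Finite 0) with (Finite (c * 0)) by (f_equal; ring).
    apply (is_lim_seq_scal_l (fun m => / (2 * INR m + 1)) c 0).
    apply is_lim_seq_inv_two_INR. }
  assert (Hn : forall m, 0 < sin_node m k).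
  { intros m; pose proof (two_INR_pos m).
    unfold sin_node; fold c; apply Rdiv_lt_0_compat; lra. }
  apply (is_lim_seq_ext (fun m => c * (sin (sin_node m k) / sin_node m k))).
  - intros m; pose proof (two_INR_pos m); specialize (Hn m).
    replace (2 * INR m + 1) with (c / sin_node m k); [field; lra|].
    unfold sin_node; fold c; field; lra.
  - replace (Finite c) with (Rbar_mult c 1) by (simpl; f_equal; ring).
    apply is_lim_seq_scal_l.
    apply (is_lim_comp_seq (fun x => sin x / x) _ 0); [apply is_lim_sinc_0| |exact L0].
    exists O; intros m _ E; injection E as E; specialize (Hn m); lra.
Qed.

Lemma is_lim_seq_inv_pow u l n :
  l <> 0 -> is_lim_seq u (Finite l) -> is_lim_seq (fun m => / u m ^ n) (/ l ^ n).
Proof.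
  intros Hl Hu.
  apply (is_lim_seq_continuous (fun x => / x ^ n) u l); [|exact Hu].
  apply derivable_continuous_pt.
  apply ex_derive_Reals_0; auto_derive; apply pow_nonzero, Hl.
Qed.

Lemma Rinv_pow_le_sq x y n :
  1 <= x <= y -> (2 <= n)%nat -> Rabs (/ y ^ n) <= / x ^ 2.
Proof.
  intros Hx Hn.
  assert (0 < x ^ 2) by nra.
  assert (x ^ 2 <= y ^ n).
  { apply Rle_trans with (y ^ 2); [apply pow_incr; lra|apply Rle_pow; [lra|lia]]. }
  rewrite Rabs_pos_eq; [apply Rinv_le_contravar; lra|].
  left; apply Rinv_0_lt_compat; lra.
Qed.

(** After division by [(2 m + 1)^n] each term tends to [1 / (k PI)^n] and is dominated by [1 / k^2],
    so [tannery] applies. *)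
Lemma is_series_sin_node n l : (2 <= n)%nat ->
  is_lim_seq (fun m => / (2 * INR m + 1) ^ n
                       * psum (fun k => / sin (sin_node m k) ^ n) m) (Finite l) ->
  is_series (fun k => / INR (S k) ^ n) (PI ^ n * l).
Proof.
  intros Hn Hl; pose proof PI_RGT_0.
  assert (E : forall k, PI ^ n * / (INR (S k) * PI) ^ n = / INR (S k) ^ n).
  { intros k; rewrite Rpow_mult_distr; field.
    split; apply pow_nonzero; [apply not_0_INR; lia|lra]. }
  apply (is_series_ext _ _ _ E).
  apply (is_series_scal (PI ^ n) (fun k => / (INR (S k) * PI) ^ n) l).
  apply (tannery (fun m k => / ((2 * INR m + 1) * sin (sin_node m k)) ^ n) _
           (fun k => / INR (S k) ^ 2) (fun m => m)).
  - intros k; apply is_lim_seq_inv_pow; [|apply is_lim_seq_sin_node_scaled].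
    pose proof (INR_S_pos k); nra.
  - apply ex_series_inv_sq.
  - exists O; intros m _ k Hk; apply Rinv_pow_le_sq; [|exact Hn].
    split; [apply INR_S_ge1|apply sin_node_scaled_bound, Hk].
  - intros K; exists K; auto.
  - eapply is_lim_seq_ext; [|exact Hl].
    intros m; cbv beta; rewrite <- psum_scal; apply psum_ext; intros k Hk.
    rewrite Rpow_mult_distr, Rinv_mult; reflexivity.
Qed.

Lemma is_series_inv_sq : is_series (fun k => / INR (S k) ^ 2) (PI ^ 2 / 6).
Proof.
  replace (PI ^ 2 / 6) with (PI ^ 2 * (1 / 6 - 0 * 0 / 6)) by field.
  apply is_series_sin_node; [lia|].
  (* With [y = 1 / (2 m + 1)] the scaled sum is [(1 - y^2) / 6]; the zeros in the rewritten value
     above stand for the limit of [y]. *)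
  apply (is_lim_seq_ext
    (fun m => 1 / 6 - / (2 * INR m + 1) * / (2 * INR m + 1) / 6)).
  - intros m; rewrite (proj1 (sin_node_power_sums m)).
    pose proof (two_INR_pos m); field; lra.
  - apply is_lim_seq_minus'; [apply is_lim_seq_const|].
    apply is_lim_seq_mult'; [|apply is_lim_seq_const].
    apply is_lim_seq_mult'; apply is_lim_seq_inv_two_INR.
Qed.

Lemma is_series_inv_pow4 : is_series (fun k => / INR (S k) ^ 4) (PI ^ 4 / 90).
Proof.
  replace (PI ^ 4 / 90) with (PI ^ 4 * (1 / 90 + 1 / 9 * (0 * 0) - 11 / 90 * (0 * 0 * (0 * 0)))) by field.
  apply is_series_sin_node; [lia|].
  (* This is [(1 - y^2)^2 / 36 - (1 - y^2) (1 - 9 y^2) / 60] expanded in [y = 1 / (2 m + 1)]. *)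
  apply (is_lim_seq_ext
    (fun m => 1 / 90 + 1 / 9 * (/ (2 * INR m + 1) * / (2 * INR m + 1))
      - 11 / 90 * (/ (2 * INR m + 1) * / (2 * INR m + 1)
         * (/ (2 * INR m + 1) * / (2 * INR m + 1))))).
  - intros m; rewrite (proj2 (sin_node_power_sums m)).
    pose proof (two_INR_pos m); field; lra.
  - repeat first [apply is_lim_seq_minus' | apply is_lim_seq_plus'
      | apply is_lim_seq_mult' | apply is_lim_seq_const
      | apply is_lim_seq_inv_two_INR].
Qed.

(** * Weighted truncations of [psi_G] *)

Definition pole_term (w : R) (m : nat) : R := / (INR (S m) * (INR (S m) + w)).

Definition no_pole (w : R) : Prop := forall m, INR (S m) + w <> 0.

Definition weight (c : nat -> R) : Prop := forall m, 0 <= c m <= 1.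

(* With [w = z - 1], [a = (L - 1) / 2], [b = 1 + gamma]: constant weights [1]
   give [psi_G z], and the indicator of [m < N] gives its truncation to the
   first [N] poles. *)
Definition wpsi (a b : R) (c : nat -> R) (w : R) : R :=
  a - b * w + w ^ 2 * Series (fun m => c m * pole_term w m).

Lemma Series_psum_split u M :
  ex_series u -> Series u = psum u M + Series (fun i => u (M + i)%nat).
Proof.
  intros Hu; induction M as [|M IH]; simpl.
  - rewrite Rplus_0_l; reflexivity.
  - rewrite IH, Series_incr_1.
    + rewrite Nat.add_0_r, Rplus_assoc; do 2 f_equal.
      apply Series_ext; intros i; f_equal; lia.
    + apply ex_series_incr_n, Hu.
Qed.

Lemma Series_ge_term u n :
  (forall m, 0 <= u m) -> ex_series u -> u n <= Series u.
Proof.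
  intros Hp Hu; eapply Rle_trans; [|apply (psum_le_Series u (S n) Hp Hu)].
  simpl; enough (0 <= psum u n) by lra.
  induction n as [|n IH]; simpl; [lra|]; specialize (Hp n); lra.
Qed.

Lemma pole_term_abs_le w m :
  2 * Rabs w <= INR (S m) -> Rabs (pole_term w m) <= 2 * / INR (S m) ^ 2.
Proof.
  intros H; pose proof (INR_S_ge1 m); unfold pole_term.
  set (k := INR (S m)) in *.
  assert (k / 2 <= k + w) by (revert H; unfold Rabs; destruct Rcase_abs; lra).
  rewrite Rabs_pos_eq by (left; apply Rinv_0_lt_compat; nra).
  replace (2 * / k ^ 2) with (/ (k * (k / 2))) by (field; lra).
  apply Rinv_le_contravar; nra.
Qed.

Lemma weight_abs_le c m x y : weight c -> Rabs x <= y -> Rabs (c m * x) <= y.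
Proof.
  intros Hc Hx; specialize (Hc m); pose proof (Rabs_pos x).
  rewrite Rabs_mult, (Rabs_pos_eq (c m)) by lra; nra.
Qed.

Lemma ex_series_pole c w : weight c -> ex_series (fun m => c m * pole_term w m).
Proof.
  intros Hc; destruct (nfloor_ex (2 * Rabs w)) as [n [_ Hn]];
    [pose proof (Rabs_pos w); lra|].
  apply (ex_series_incr_n (fun m => c m * pole_term w m) n).
  apply (ex_series_le (V := R_CompleteNormedModule) _
           (fun i => 2 * / INR (S (n + i)) ^ 2)).
  - intros i; apply weight_abs_le; [exact Hc|]; apply pole_term_abs_le.
    rewrite S_INR, plus_INR; pose proof (pos_INR i); lra.
  - destruct (ex_series_inv_sq) as [l Hl].
    assert (E : ex_series (fun k => 2 * / INR (S k) ^ 2)).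
    { exists (2 * l); apply (is_series_scal 2 _ l), Hl. }
    exact (proj1 (ex_series_incr_n (fun k => 2 * / INR (S k) ^ 2) n) E).
Qed.

Lemma lipschitz_continuity_pt f x d K :
  0 < d -> (forall y, Rabs (y - x) < d -> Rabs (f y - f x) <= K * Rabs (y - x)) ->
  continuity_pt f x.
Proof.
  intros Hd H eps He.
  set (K' := Rabs K + 1).
  assert (HK : 0 < K') by (pose proof (Rabs_pos K); unfold K'; lra).
  exists (Rmin d (eps / K')); split.
  - apply Rmin_Rgt; split; [exact Hd|apply Rdiv_lt_0_compat; lra].
  - intros y [_ Hy]; simpl in *; unfold R_dist in *.
    apply Rmin_Rgt in Hy; destruct Hy as [Hy1 Hy2].
    eapply Rle_lt_trans; [apply H, Hy1|].
    apply Rgt_lt, Rlt_div_r in Hy2; [|exact HK].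
    pose proof (Rabs_pos (y - x)); pose proof (Rle_abs K).
    unfold K' in Hy2; nra.
Qed.

(** The margin [1 / 2] to the first remaining pole [-(M + 1)] keeps [k + x] and [k + y] above
    [(i + 1) / 2], which makes the Lipschitz constants summable over [i]. *)
Lemma pole_term_lipschitz M i x y :
  - INR M - 1 / 2 <= x -> - INR M - 1 / 2 <= y ->
  Rabs (pole_term y (M + i) - pole_term x (M + i))
  <= Rabs (y - x) * (4 * / INR (S i) ^ 2).
Proof.
  intros Hx Hy; unfold pole_term.
  rewrite (S_INR (M + i)), plus_INR, (S_INR i).
  pose proof (pos_INR i); pose proof (pos_INR M).
  set (k := INR M + INR i + 1); set (p := INR i + 1).
  assert (p / 2 <= k + x) by (unfold k, p; lra).
  assert (p / 2 <= k + y) by (unfold k, p; lra).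
  assert (1 <= p) by (unfold p; lra).
  assert (1 <= k) by (unfold k; lra).
  replace (/ (k * (k + y)) - / (k * (k + x)))
    with (- (y - x) * / (k * ((k + x) * (k + y)))) by (field; lra).
  rewrite Rabs_mult, Rabs_Ropp.
  apply Rmult_le_compat_l; [apply Rabs_pos|].
  assert (p / 2 * (p / 2) <= (k + x) * (k + y))
    by (apply Rmult_le_compat; lra).
  rewrite Rabs_pos_eq by (left; apply Rinv_0_lt_compat; nra).
  replace (4 * / p ^ 2) with (/ (p / 2 * (p / 2))) by (field; lra).
  apply Rinv_le_contravar; nra.
Qed.

Lemma pole_tail_continuity c M x : weight c -> - INR M - 1 / 2 < x ->
  continuity_pt (fun w => Series (fun i => c (M + i)%nat * pole_term w (M + i))) x.
Proof.
  intros Hc Hx.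
  apply (lipschitz_continuity_pt _ x (x + INR M + 1 / 2)
           (4 * Series (fun i => / INR (S i) ^ 2))); [lra|].
  intros y Hy.
  assert (Hy' : - INR M - 1 / 2 <= y)
    by (revert Hy; unfold Rabs; destruct Rcase_abs; lra).
  assert (E : forall w, ex_series (fun i => c (M + i)%nat * pole_term w (M + i))).
  { intros w; apply (ex_series_incr_n (fun m => c m * pole_term w m) M).
    apply ex_series_pole, Hc. }
  rewrite <- Series_minus by apply E.
  replace (4 * _ * _) with (Series (fun i => Rabs (y - x) * 4 * / INR (S i) ^ 2))
    by (rewrite Series_scal_l; ring).
  assert (B : forall i, Rabs (c (M + i)%nat * pole_term y (M + i)
      - c (M + i)%nat * pole_term x (M + i)) <= Rabs (y - x) * 4 * / INR (S i) ^ 2).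
  { intros i; rewrite <- Rmult_minus_distr_l.
    apply weight_abs_le; [exact Hc|].
    rewrite Rmult_assoc; apply pole_term_lipschitz; lra. }
  assert (EB : ex_series (fun i => Rabs (y - x) * 4 * / INR (S i) ^ 2)).
  { destruct ex_series_inv_sq as [l Hl]; exists (Rabs (y - x) * 4 * l).
    apply (is_series_scal (Rabs (y - x) * 4) _ l), Hl. }
  eapply Rle_trans; [apply Series_Rabs|].
  - apply (ex_series_le (V := R_CompleteNormedModule) _
             (fun i => Rabs (y - x) * 4 * / INR (S i) ^ 2)); [|exact EB].
    intros i; change norm with Rabs; rewrite Rabs_Rabsolu; apply B.
  - apply Series_le; [|exact EB].
    intros i; split; [apply Rabs_pos|apply B].
Qed.

Lemma wpsi_continuity a b c x : weight c -> - 1 / 2 < x ->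
  continuity_pt (wpsi a b c) x.
Proof.
  intros Hc Hx; unfold wpsi.
  pose proof (pole_tail_continuity c 0 x Hc ltac:(simpl; lra)) as H.
  apply continuity_pt_plus; [reg|].
  apply continuity_pt_mult; [reg|exact H].
Qed.

Lemma psum_continuity (f : nat -> R -> R) n x :
  (forall m, (m < n)%nat -> continuity_pt (f m) x) ->
  continuity_pt (fun w => psum (fun m => f m w) n) x.
Proof.
  induction n as [|n IH]; simpl; intros H.
  - apply continuity_pt_const; intros ? ?; reflexivity.
  - apply (continuity_pt_plus (fun w => psum (fun m => f m w) n));
      [apply IH; intros; apply H; lia | apply H; lia].
Qed.

(** * Convexity on the positive half-line *)

(** Since [w^2 / (k (k + w)) = w / k - 1 + k / (k + w)], each summand is affine plus a convex simple
    pole; [u] is the second difference of that pole. The weight [c O = 1] makes the inequality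
    strict. *)
Lemma wpsi_convex a b c x y z : weight c -> c O = 1 -> -1 < x < y -> y < z ->
  (z - x) * wpsi a b c y < (z - y) * wpsi a b c x + (y - x) * wpsi a b c z.
Proof.
  intros Hc Hc0 Hxy Hyz; unfold wpsi.
  pose proof (fun w => ex_series_pole c w Hc) as E.
  set (u := fun m => c m * ((y - x) * (z - y) * (z - x) * INR (S m)
    / ((INR (S m) + x) * (INR (S m) + y) * (INR (S m) + z)))).
  assert (Hu : is_series u
     ((z - y) * x ^ 2 * Series (fun m => c m * pole_term x m)
      + (y - x) * z ^ 2 * Series (fun m => c m * pole_term z m)
      - (z - x) * y ^ 2 * Series (fun m => c m * pole_term y m))).
  { assert (Ex : forall m,
      (z - y) * x ^ 2 * (c m * pole_term x m) + (y - x) * z ^ 2 * (c m * pole_term z m)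
      - (z - x) * y ^ 2 * (c m * pole_term y m) = u m).
    { intros m; unfold u, pole_term; pose proof (INR_S_ge1 m); field; lra. }
    apply (is_series_ext _ _ _ Ex).
    apply (is_series_minus (V := R_NormedModule)).
    - apply (is_series_plus (V := R_NormedModule)).
      + apply (is_series_scal ((z - y) * x ^ 2) _ _ (Series_correct _ (E x))).
      + apply (is_series_scal ((y - x) * z ^ 2) _ _ (Series_correct _ (E z))).
    - apply (is_series_scal ((z - x) * y ^ 2) _ _ (Series_correct _ (E y))). }
  assert (Hpos : forall m, 0 < (y - x) * (z - y) * (z - x) * INR (S m)
    / ((INR (S m) + x) * (INR (S m) + y) * (INR (S m) + z))).
  { intros m; pose proof (INR_S_ge1 m).
    apply Rdiv_lt_0_compat; repeat apply Rmult_lt_0_compat; lra. }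
  pose proof (Series_ge_term u 0) as G.
  rewrite (is_series_unique _ _ Hu) in G.
  assert (G1 : 0 < u O) by (unfold u; rewrite Hc0, Rmult_1_l; apply Hpos).
  specialize (G ltac:(intros m; specialize (Hpos m); specialize (Hc m);
    unfold u; apply Rmult_le_pos; lra) ltac:(eexists; exact Hu)).
  nra.
Qed.

(** * Monotonicity between consecutive poles *)

(** Division by [w] turns each summand into [1 / k - 1 / (k + w)], which increases between poles;
    only [a / w] decreases, and term [j] outweighs it. *)
Lemma wpsi_div_increasing a b c j x y : weight c -> c j = 1 -> 0 <= a < 1 ->
  - INR (S (S j)) < x -> x < y -> y < - INR (S j) ->
  wpsi a b c x / x < wpsi a b c y / y.
Proof.
  intros Hc Hcj Ha Hx Hxy Hy; unfold wpsi.
  pose proof (fun w => ex_series_pole c w Hc) as E.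
  pose proof (INR_S_ge1 j).
  set (u := fun m => c m * ((y - x) / ((INR (S m) + x) * (INR (S m) + y)))).
  assert (Hsg : forall m, 0 < (INR (S m) + x) * (INR (S m) + y)).
  { intros m; destruct (Nat.le_gt_cases m j) as [Hm|Hm].
    - apply le_n_S, le_INR in Hm; nra.
    - assert (INR (S (S j)) <= INR (S m)) by (apply le_INR; lia); nra. }
  assert (Hnx : forall m, INR (S m) + x <> 0).
  { intros m E0; specialize (Hsg m); rewrite E0 in Hsg; lra. }
  assert (Hny : forall m, INR (S m) + y <> 0).
  { intros m E0; specialize (Hsg m); rewrite E0 in Hsg; lra. }
  assert (Hu : is_series u (y * Series (fun m => c m * pole_term y m)
      - x * Series (fun m => c m * pole_term x m))).
  { assert (Ex : forall m, y * (c m * pole_term y m) - x * (c m * pole_term x m) = u m).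
    { intros m; unfold u, pole_term; pose proof (INR_S_ge1 m); field.
      repeat split; auto; lra. }
    apply (is_series_ext _ _ _ Ex).
    apply (is_series_minus (V := R_NormedModule)).
    - apply (is_series_scal y _ _ (Series_correct _ (E y))).
    - apply (is_series_scal x _ _ (Series_correct _ (E x))). }
  pose proof (Series_ge_term u j) as G.
  rewrite (is_series_unique _ _ Hu) in G.
  specialize (G ltac:(intros m; specialize (Hsg m); specialize (Hc m);
    unfold u; apply Rmult_le_pos; [lra|apply Rdiv_le_0_compat; lra])
    ltac:(eexists; exact Hu)).
  (* Both factors of the denominator lie in [(-1, 0)], so their product is at most 1. *)
  assert (G1 : y - x <= u j).
  { unfold u; rewrite Hcj, Rmult_1_l.
    apply Rle_div_r; [apply Hsg|].
    rewrite (S_INR (S j)) in Hx.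
    assert ((INR (S j) + x) * (INR (S j) + y) <= 1) by nra.
    nra. }
  (* Here [x y > 1] and [a < 1]. *)
  assert (G2 : a / x - a / y < y - x).
  { replace (a / x - a / y) with ((y - x) * (a / (x * y))) by (field; lra).
    rewrite <- (Rmult_1_r (y - x)) at 2; apply Rmult_lt_compat_l; [lra|].
    apply Rlt_div_l; nra. }
  replace ((a - b * x + x ^ 2 * Series (fun m => c m * pole_term x m)) / x)
    with (a / x - b + x * Series (fun m => c m * pole_term x m)) by (field; lra).
  replace ((a - b * y + y ^ 2 * Series (fun m => c m * pole_term y m)) / y)
    with (a / y - b + y * Series (fun m => c m * pole_term y m)) by (field; lra).
  lra.
Qed.

(** * Location of the zeros *)

Lemma pole_term_continuity_pt m x :
  INR (S m) + x <> 0 -> continuity_pt (fun w => pole_term w m) x.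
Proof.
  intros H; unfold pole_term; pose proof (INR_S_ge1 m).
  set (k := INR (S m)) in *.
  apply derivable_continuous_pt, ex_derive_Reals_0; auto_derive.
  apply Rmult_integral_contrapositive_currified; lra.
Qed.

(* [wpsi] times [(w + j + 1) (w + j + 2)] extends continuously to the closed
   interval between the two poles, with opposite signs at the ends. *)
Lemma wpsi_neg_root a b c j : weight c -> c j = 1 -> c (S j) = 1 ->
  exists r, - INR (S (S j)) < r < - INR (S j) /\ wpsi a b c r = 0.
Proof.
  intros Hc Hc0 Hc1.
  set (tail := fun w => Series (fun i => c (S (S j) + i)%nat * pole_term w (S (S j) + i))).
  set (head := fun w => psum (fun m => c m * pole_term w m) j).
  (* The last summand is the contribution of the two boundary poles with denominators cleared; it
     alone survives at the end points. *)
  set (f := fun w => (w + INR (S j)) * (w + INR (S (S j)))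
     * (a - b * w + w ^ 2 * (head w + tail w))
     + w ^ 2 * ((w + INR (S (S j))) / INR (S j) + (w + INR (S j)) / INR (S (S j)))).
  pose proof (INR_S_ge1 j) as Hj1; pose proof (S_INR (S j)) as Hj2.
  assert (Hcont : forall x, - INR (S (S j)) <= x <= - INR (S j) -> continuity_pt f x).
  { intros x Hx; unfold f.
    assert (C1 : continuity_pt head x).
    { apply (psum_continuity (fun m w => c m * pole_term w m)); intros m Hm.
      apply (continuity_pt_scal (fun w => pole_term w m)), pole_term_continuity_pt.
      assert (INR (S m) < INR (S j)) by (apply lt_INR; lia); lra. }
    assert (C2 : continuity_pt tail x).
    { apply pole_tail_continuity; [exact Hc|lra]. }
    repeat first [apply continuity_pt_plus | apply continuity_pt_mult
      | exact C1 | exact C2 | solve [reg]]. }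
  assert (F0 : f (- INR (S j)) = INR (S j))
    by (unfold f; rewrite Hj2; field; lra).
  assert (F1 : f (- INR (S (S j))) = - INR (S (S j)))
    by (unfold f; rewrite Hj2; field; lra).
  destruct (Ranalysis5.IVT_interv f (- INR (S (S j))) (- INR (S j)) Hcont
              ltac:(lra) ltac:(lra) ltac:(lra)) as [r [Hr Hfr]].
  assert (r <> - INR (S j)) by (intros E; rewrite E in Hfr; lra).
  assert (r <> - INR (S (S j))) by (intros E; rewrite E in Hfr; lra).
  exists r; split; [lra|].
  assert (D : f r = (r + INR (S j)) * (r + INR (S (S j))) * wpsi a b c r).
  { unfold f, wpsi; rewrite (Series_psum_split _ (S (S j)) (ex_series_pole c r Hc)).
    fold (tail r); cbn [psum]; fold (head r).
    rewrite Hc0, Hc1; unfold pole_term; field; lra. }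
  rewrite D in Hfr; apply Rmult_integral in Hfr; destruct Hfr as [Hfr|Hfr]; [|exact Hfr].
  apply Rmult_integral in Hfr; destruct Hfr; lra.
Qed.

(** With all weights 1 the sum at [w = 1] telescopes to 1, and smaller weights only decrease it. *)
Lemma wpsi_at_1 a b c : weight c -> a < b - 1 -> wpsi a b c 1 < 0.
Proof.
  intros Hc Hab; unfold wpsi.
  pose proof (is_series_unique _ _ is_series_telescope) as U.
  enough (Series (fun m => c m * pole_term 1 m) <= 1) by lra.
  eapply Rle_trans; [|right; exact U]; apply Series_le; [|eexists; apply is_series_telescope].
  intros m; specialize (Hc m); unfold pole_term; pose proof (INR_S_ge1 m).
  rewrite (S_INR (S m)).
  replace (/ INR (S m) - / (INR (S m) + 1)) with (/ (INR (S m) * (INR (S m) + 1)))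
    by (field; lra).
  assert (0 < / (INR (S m) * (INR (S m) + 1)))
    by (apply Rinv_0_lt_compat; nra).
  set (t := / _) in *; split; nra.
Qed.

Lemma pole_term_pos w m : -1 < w -> 0 < pole_term w m.
Proof.
  intros Hw; pose proof (INR_S_ge1 m); unfold pole_term.
  apply Rinv_0_lt_compat; nra.
Qed.

Lemma wpsi_small_pos a b c w :
  weight c -> 0 < a -> 0 < b -> -1 < w <= 0 -> 0 < wpsi a b c w.
Proof.
  intros Hc Ha Hb Hw; unfold wpsi.
  assert (P : forall m, 0 <= c m * pole_term w m).
  { intros m; specialize (Hc m); pose proof (pole_term_pos w m ltac:(lra)).
    apply Rmult_le_pos; lra. }
  pose proof (Series_ge_term _ O P (ex_series_pole c w Hc)) as G.
  specialize (P O); cbv beta in *.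
  set (s := Series _) in *; assert (0 <= w ^ 2 * s) by (apply Rmult_le_pos; nra).
  nra.
Qed.

(* Numerically [sum_(k <= 8) 8 / (k (k + 8)) = 2.055]. *)
Lemma wpsi_large_pos a b c w :
  weight c -> (forall m, (m < 8)%nat -> c m = 1) -> 0 < a -> b <= 2 -> 8 <= w ->
  0 < wpsi a b c w.
Proof.
  intros Hc Hc1 Ha Hb Hw; unfold wpsi.
  assert (P : forall m, 0 <= c m * pole_term w m).
  { intros m; specialize (Hc m); pose proof (pole_term_pos w m ltac:(lra)).
    apply Rmult_le_pos; lra. }
  pose proof (psum_le_Series _ 8 P (ex_series_pole c w Hc)) as G.
  set (s := Series _) in *.
  assert (Q : psum (fun m => 8 * pole_term 8 m) 8
              <= w * psum (fun m => c m * pole_term w m) 8).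
  { rewrite <- psum_scal; apply psum_le; intros k Hk; rewrite Hc1 by exact Hk.
    unfold pole_term; pose proof (INR_S_ge1 k).
    replace (w * (1 * / (INR (S k) * (INR (S k) + w))))
      with (/ INR (S k) - / (INR (S k) + w)) by (field; lra).
    replace (8 * / (INR (S k) * (INR (S k) + 8)))
      with (/ INR (S k) - / (INR (S k) + 8)) by (field; lra).
    assert (/ (INR (S k) + w) <= / (INR (S k) + 8))
      by (apply Rinv_le_contravar; lra).
    lra. }
  assert (Q2 : 2 <= psum (fun m => 8 * pole_term 8 m) 8)
    by (unfold pole_term; simpl; lra).
  assert (w * psum (fun m => c m * pole_term w m) 8 <= w * s)
    by (apply Rmult_le_compat_l; lra).
  assert (0 <= w * (w * s - b)) by (apply Rmult_le_pos; lra).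
  nra.
Qed.

(** The intervals are in [w] and numbered from right to left, to match the decreasing order of
    [beta]; index [S (S j)] is the gap between the poles [-(j + 2)] and [-(j + 1)]. The range
    [(-1, 0]] is left out because [wpsi] is positive there. *)
Definition root_lo (k : nat) : R :=
  match k with O => 1 | S O => 0 | S (S j) => - INR (S (S j)) end.

Definition root_hi (k : nat) : R :=
  match k with O => 8 | S O => 1 | S (S j) => - INR (S j) end.

(** The sign of [wpsi] to the left of its root in interval [k]. *)
Definition root_sign (k : nat) : R := match k with O => -1 | _ => 1 end.

(** The signs on both sides are recorded with the root: they give its uniqueness, and through them
    pointwise convergence of the functions forces convergence of the roots. *)
Definition is_root_in (a b : R) (c : nat -> R) (k : nat) (r : R) : Prop :=
  root_lo k < r < root_hi k /\ wpsi a b c r = 0 /\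
  forall x, root_lo k < x < root_hi k ->
    (x < r -> 0 < root_sign k * wpsi a b c x) /\
    (r < x -> root_sign k * wpsi a b c x < 0).

Lemma wpsi_root a b c k :
  weight c -> (forall m, (m < 8)%nat -> c m = 1) ->
  (forall m, (m < k)%nat -> c m = 1) ->
  0 < a -> a < b - 1 -> b <= 2 -> exists r, is_root_in a b c k r.
Proof.
  intros Hc Hc8 Hck Ha Hab Hb; unfold is_root_in.
  pose proof (wpsi_at_1 a b c Hc Hab) as F1.
  pose proof (wpsi_small_pos a b c 0 Hc Ha ltac:(lra) ltac:(lra)) as F0.
  pose proof (wpsi_large_pos a b c 8 Hc Hc8
    Ha Hb ltac:(lra)) as F8.
  pose proof (Hc8 O ltac:(lia)) as Hc0.
  destruct k as [|[|j]]; cbn [root_lo root_hi root_sign].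
  - destruct (Ranalysis5.IVT_interv (wpsi a b c) 1 8) as [r [Hr E]];
      [intros; apply wpsi_continuity; [exact Hc|lra]|lra|lra|lra|].
    assert (r <> 1) by (intros E1; rewrite E1 in E; lra).
    assert (r <> 8) by (intros E1; rewrite E1 in E; lra).
    (* A strictly convex function that is negative at 1 and zero at [r] changes sign only once to
       the right of 1; the next case mirrors this to the left. *)
    exists r; repeat split; try lra; intros Hx.
    + pose proof (wpsi_convex a b c 1 x r Hc Hc0 ltac:(lra) ltac:(lra)); nra.
    + pose proof (wpsi_convex a b c 1 r x Hc Hc0 ltac:(lra) ltac:(lra)); nra.
  - destruct (Ranalysis5.IVT_interv (fun x => - wpsi a b c x) 0 1) as [r [Hr E]];
      [intros; apply continuity_pt_opp, wpsi_continuity; [exact Hc|lra]|lra|lra|lra|].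
    assert (r <> 0) by (intros E1; rewrite E1 in E; lra).
    assert (r <> 1) by (intros E1; rewrite E1 in E; lra).
    exists r; repeat split; try lra; intros Hx.
    + pose proof (wpsi_convex a b c x r 1 Hc Hc0 ltac:(lra) ltac:(lra)); nra.
    + pose proof (wpsi_convex a b c r x 1 Hc Hc0 ltac:(lra) ltac:(lra)); nra.
  - pose proof (Hck j ltac:(lia)) as Hj.
    destruct (wpsi_neg_root a b c j Hc Hj (Hck (S j) ltac:(lia))) as [r [Hr E]].
    pose proof (INR_S_ge1 j).
    (* As [x < 0], the sign of [wpsi] is opposite to that of the increasing quotient. *)
    assert (D : forall x, x < - INR (S j) -> wpsi a b c x = wpsi a b c x / x * x)
      by (intros; field; lra).
    assert (D0 : wpsi a b c r / r = 0) by (rewrite E; field; lra).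
    exists r; repeat split; try lra; intros Hx; rewrite D by lra.
    + pose proof (wpsi_div_increasing a b c j x r Hc Hj ltac:(lra)
        ltac:(lra) ltac:(lra) ltac:(lra)); nra.
    + pose proof (wpsi_div_increasing a b c j r x Hc Hj ltac:(lra)
        ltac:(lra) ltac:(lra) ltac:(lra)); nra.
Qed.

Lemma wpsi_zero_located a b c w :
  weight c -> (forall m, (m < 8)%nat -> c m = 1) -> 0 < a -> a < b - 1 -> b <= 2 ->
  no_pole w -> wpsi a b c w = 0 -> exists k, root_lo k < w < root_hi k.
Proof.
  intros Hc Hc1 Ha Hab Hb Hw E.
  assert (w <> -1) by (specialize (Hw O); simpl in Hw; lra).
  destruct (Rlt_le_dec (-1) w) as [Hw1|Hw1].
  - assert (0 < w).
    { apply Rnot_le_lt; intros Hw0.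
      pose proof (wpsi_small_pos a b c w Hc Ha ltac:(lra) ltac:(lra)); lra. }
    assert (w < 8).
    { apply Rnot_le_lt; intros Hw0.
      pose proof (wpsi_large_pos a b c w Hc Hc1 Ha Hb Hw0); lra. }
    assert (w <> 1).
    { intros E1; pose proof (wpsi_at_1 a b c Hc Hab); rewrite E1 in E; lra. }
    destruct (Rlt_le_dec w 1); [exists 1%nat|exists O]; simpl; lra.
  (* This gives [-(n + 2) < w <= -(n + 1)], and [no_pole] excludes equality. *)
  - destruct (nfloor_ex (- w - 1)) as [n Hn]; [lra|].
    exists (S (S n)); cbn [root_lo root_hi]; specialize (Hw n).
    rewrite (S_INR (S n)); rewrite (S_INR n) in *; lra.
Qed.

Lemma is_root_in_unique a b c k r x :
  is_root_in a b c k r -> root_lo k < x < root_hi k -> wpsi a b c x = 0 -> x = r.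
Proof.
  intros [_ [_ H]] Hx E; destruct (H x Hx) as [H1 H2]; rewrite E in *.
  destruct (Rtotal_order x r) as [T|[T|T]]; [|exact T|]; exfalso.
  - specialize (H1 T); lra.
  - specialize (H2 T); lra.
Qed.

Lemma root_interval_no_pole k x : root_lo k < x < root_hi k -> no_pole x.
Proof.
  intros Hx m E; destruct k as [|[|j]]; cbn [root_lo root_hi] in Hx;
    pose proof (INR_S_ge1 m); try lra.
  assert (INR (S j) < INR (S m) < INR (S (S j))) as [H1 H2] by lra.
  apply INR_lt in H1; apply INR_lt in H2; lia.
Qed.

Lemma root_hi_le_lo k : root_hi (S k) <= root_lo k.
Proof.
  destruct k as [|[|k]]; cbn [root_lo root_hi]; [lra|simpl; lra|lra].
Qed.

Lemma root_intervals_ordered (r : nat -> R) j k :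
  (forall i, (i <= k)%nat -> root_lo i < r i < root_hi i) -> (j < k)%nat -> r k < r j.
Proof.
  intros Hr Hjk; revert Hr; induction Hjk as [|k Hjk IH]; intros Hr.
  - pose proof (Hr j ltac:(lia)); pose proof (Hr (S j) ltac:(lia)).
    pose proof (root_hi_le_lo j); lra.
  - pose proof (Hr k ltac:(lia)); pose proof (Hr (S k) ltac:(lia)).
    pose proof (root_hi_le_lo k); specialize (IH ltac:(intros; apply Hr; lia)); lra.
Qed.

(** * The numerators of the truncations *)

(** The bound is inclusive: [n + 1] poles are kept, at [w = -1, ..., -(n + 1)]. *)
Definition trunc (n m : nat) : R := if (m <=? n)%nat then 1 else 0.

Lemma trunc_weight n : weight (trunc n).
Proof. intros m; unfold trunc; destruct (m <=? n)%nat; lra. Qed.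

Lemma trunc_1 n m : (m <= n)%nat -> trunc n m = 1.
Proof. intros H; unfold trunc; rewrite (proj2 (Nat.leb_le m n) H); reflexivity. Qed.

Lemma Series_0 u : (forall m, u m = 0) -> Series u = 0.
Proof.
  intros H; rewrite (Series_ext u (fun m => 0 * u m)).
  - rewrite Series_scal_l; ring.
  - intros m; rewrite H; ring.
Qed.

Lemma wpsi_trunc a b n w :
  wpsi a b (trunc n) w = a - b * w + w ^ 2 * psum (pole_term w) (S n).
Proof.
  unfold wpsi.
  rewrite (Series_psum_split _ (S n) (ex_series_pole _ w (trunc_weight n))).
  rewrite (psum_ext _ (pole_term w)).
  - rewrite Series_0; [ring|].
    intros i; unfold trunc.
    rewrite (proj2 (Nat.leb_gt (S n + i) n)) by lia; ring.
  - intros k Hk; rewrite trunc_1 by lia; ring.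
Qed.

(** The product of [1 + z / k] for [k = 1, ..., n]: the poles of the truncation in [z = w + 1],
    apart from [z = 0]. *)
Fixpoint den_coef (n : nat) : nat -> R :=
  match n with
  | O => fun i => match i with O => 1 | _ => 0 end
  | S p => fun i => den_coef p i + / INR (S p) * shift (den_coef p) i
  end.

(** The numerator of [z * wpsi (z - 1)] over [den_coef n], where the factor [z] cancels the pole at
    0. It starts from [z (a - b (z - 1)) + (z - 1)^2]; a further pole multiplies it by [1 + z / q]
    and adds [z (z - 1)^2 / (q (q + 1))] times the old denominator, with [q = p + 1]. *)
Fixpoint num_coef (a b : R) (n : nat) : nat -> R :=
  match n with
  | O => fun i =>
      match i with O => 1 | S O => a + b - 2 | S (S O) => 1 - b | _ => 0 end
  | S p => fun i =>
      num_coef a b p i + (/ INR (S p) * shift (num_coef a b p) i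
      + / (INR (S p) * INR (S (S p))) * (shift (den_coef p) i
          + (-2 * shift (shift (den_coef p)) i + shift (shift (shift (den_coef p))) i)))
  end.

Lemma den_coef_deg n i : (n < i)%nat -> den_coef n i = 0.
Proof.
  revert i; induction n as [|n IH]; intros i Hi; destruct i as [|i]; try lia; simpl.
  - reflexivity.
  - rewrite !IH by lia; ring.
Qed.

Lemma num_coef_deg a b n i : (n + 2 < i)%nat -> num_coef a b n i = 0.
Proof.
  revert i; induction n as [|n IH]; intros i Hi; destruct i as [|[|[|i]]]; try lia.
  - reflexivity.
  - cbn [num_coef shift]; rewrite !IH, !den_coef_deg by lia; ring.
Qed.

Lemma num_coef_peval a b n w : no_pole w ->
  peval (num_coef a b n) (n + 2) (w + 1)
  = (w + 1) * wpsi a b (trunc n) w * peval (den_coef n) n (w + 1).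
Proof.
  intros Hw; rewrite wpsi_trunc; induction n as [|n IH].
  - specialize (Hw O); simpl in Hw; unfold peval, pole_term; simpl; field; lra.
  - pose proof (Hw (S n)) as Hn; pose proof (INR_S_ge1 n); pose proof (S_INR (S n)) as E.
    change (num_coef a b (S n)) with (fun i =>
      num_coef a b n i + (/ INR (S n) * shift (num_coef a b n) i
      + / (INR (S n) * INR (S (S n))) * (shift (den_coef n) i
          + (-2 * shift (shift (den_coef n)) i + shift (shift (shift (den_coef n))) i)))).
    change (den_coef (S n)) with (fun i =>
      den_coef n i + / INR (S n) * shift (den_coef n) i).
    rewrite (peval_plus (num_coef a b n)), (peval_plus (fun i => _ * shift _ i)).
    rewrite (peval_plus (den_coef n)), !peval_scal.
    rewrite (peval_plus (shift (den_coef n))).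
    rewrite (peval_plus (fun i => -2 * _)), !peval_scal.
    replace (S n + 2)%nat with (S (S (S n))) by lia.
    replace (n + 2)%nat with (S (S n)) in IH by lia.
    rewrite !peval_shift.
    rewrite (peval_widen (num_coef a b n) (S (S n)) (S (S (S n))))
      by (auto; intros; apply num_coef_deg; lia).
    rewrite (peval_widen (den_coef n) n (S (S n))) by (auto; apply den_coef_deg).
    rewrite (peval_widen (den_coef n) n (S n)) by (auto; apply den_coef_deg).
    rewrite IH; cbn [psum].
    change (pole_term w (S n)) with (/ (INR (S (S n)) * (INR (S (S n)) + w))).
    rewrite E in *.
    field; lra.
Qed.

(** The pole at [z = -q], [q = m + 1], contributes [z (1 - z)^2 / (q (q + 1) (1 + z / q))]; its
    coefficients of [z] to [z^4] are split into [1 / q - 1 / (q + 1)] and powers of [1 / q]. *)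
Definition laurent1 (a b : R) (n : nat) : R :=
  a + b - 2 + psum (fun m => / INR (S m) - / INR (S (S m))) n.
Definition laurent2 (b : R) (n : nat) : R :=
  1 - b - psum (fun m => / INR (S m) ^ 2) n
  - psum (fun m => / INR (S m) - / INR (S (S m))) n.
Definition laurent3 (n : nat) : R :=
  psum (fun m => / INR (S m) ^ 2) n + psum (fun m => / INR (S m) ^ 3) n.
Definition laurent4 (n : nat) : R :=
  - psum (fun m => / INR (S m) ^ 3) n - psum (fun m => / INR (S m) ^ 4) n.

(* [num_coef] is the Cauchy product of [den_coef] with the expansion of
   [z * wpsi (z - 1)] at [z = 0], which starts with [1, laurent1, ..., laurent4]. *)
Lemma num_coef_low a b n :
  let d := den_coef n in
  d O = 1 /\ num_coef a b n 0 = 1 /\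
  num_coef a b n 1 = d 1%nat + laurent1 a b n /\
  num_coef a b n 2 = d 2%nat + d 1%nat * laurent1 a b n + laurent2 b n /\
  num_coef a b n 3 = d 3%nat + d 2%nat * laurent1 a b n + d 1%nat * laurent2 b n
    + laurent3 n /\
  num_coef a b n 4 = d 4%nat + d 3%nat * laurent1 a b n + d 2%nat * laurent2 b n
    + d 1%nat * laurent3 n + laurent4 n.
Proof.
  unfold laurent1, laurent2, laurent3, laurent4.
  induction n as [|n (I & I0 & I1 & I2 & I3 & I4)].
  - simpl; repeat split; ring.
  - pose proof (INR_S_ge1 n); pose proof (S_INR (S n)) as E.
    cbv zeta; cbn [num_coef den_coef shift psum].
    rewrite I0, I1, I2, I3, I4, I, E.
    repeat split; field; lra.
Qed.

(** Newton's expression for the inverse fourth powers is additive over factors, and [1 + z / k] adds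
    [(-1 / k)^4]. *)
Lemma den_coef_power_sum n : let d := den_coef n in
  d 1%nat ^ 4 - 4 * d 1%nat ^ 2 * d 2%nat + 4 * d 1%nat * d 3%nat
  + 2 * d 2%nat ^ 2 - 4 * d 4%nat = psum (fun m => / INR (S m) ^ 4) n.
Proof.
  induction n as [|n IH]; [simpl; ring|].
  cbv zeta in *; cbn [den_coef shift psum]; rewrite <- IH.
  replace (den_coef n 0) with 1.
  - pose proof (INR_S_ge1 n); field; lra.
  - symmetry; apply (num_coef_low 0 0 n).
Qed.

(** The [n + 2] located roots exhaust the degree. Newton's expression is additive over products of
    series with constant term 1, so it splits into the share of [den_coef] and that of the
    coefficients [laurent1] to [laurent4]. *)
Lemma trunc_root_power_sum a b n r :
  (forall k, (k < n + 2)%nat -> is_root_in a b (trunc n) k (r k)) ->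
  psum (fun k => (/ (r k + 1)) ^ 4) (n + 2) =
  psum (fun m => / INR (S m) ^ 4) n
  + (laurent1 a b n ^ 4 - 4 * laurent1 a b n ^ 2 * laurent2 b n
     + 4 * laurent1 a b n * laurent3 n + 2 * laurent2 b n ^ 2 - 4 * laurent4 n).
Proof.
  intros Hr.
  destruct (power_sums (n + 2) (num_coef a b n) (fun k => r k + 1)) as [_ [_ P]].
  - apply num_coef_low.
  - intros i Hi; apply num_coef_deg, Hi.
  - intros k Hk; destruct (Hr k Hk) as [H1 [H2 _]].
    pose proof (root_interval_no_pole k (r k) H1) as Hp; split.
    + specialize (Hp O); simpl in Hp; lra.
    + rewrite (num_coef_peval a b n (r k) Hp), H2; ring.
  - intros j k Hjk.
    pose proof (root_intervals_ordered r j k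
      ltac:(intros; apply (Hr i); lia) ltac:(lia)); lra.
  - rewrite P, <- den_coef_power_sum.
    destruct (num_coef_low a b n) as (_ & _ & -> & -> & -> & ->); ring.
Qed.

(** * Convergence of the roots *)

Definition ones (m : nat) : R := 1.

Lemma ones_weight : weight ones.
Proof. intros m; unfold ones; lra. Qed.

Lemma wpsi_trunc_lim a b w :
  is_lim_seq (fun n => wpsi a b (trunc n) w) (wpsi a b ones w).
Proof.
  apply (is_lim_seq_ext (fun n => a - b * w + w ^ 2 * psum (pole_term w) (S n))).
  { intros n; symmetry; apply wpsi_trunc. }
  unfold wpsi; apply is_lim_seq_plus'; [apply is_lim_seq_const|].
  apply is_lim_seq_mult'; [apply is_lim_seq_const|].
  apply (is_lim_seq_incr_1 (psum (pole_term w))), is_series_psum.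
  rewrite (Series_ext _ (pole_term w)) by (intros; unfold ones; ring).
  apply Series_correct.
  apply (ex_series_ext (fun m => ones m * pole_term w m));
    [|apply ex_series_pole, ones_weight].
  intros m; unfold ones; apply Rmult_1_l.
Qed.

Lemma is_lim_seq_eventually_pos u l :
  is_lim_seq u (Finite l) -> 0 < l -> eventually (fun n => 0 < u n).
Proof.
  intros Hu Hl; apply is_lim_seq_spec in Hu.
  destruct (Hu (mkposreal l Hl)) as [N HN]; exists N; intros n Hn.
  specialize (HN n Hn); simpl in HN; revert HN; unfold Rabs; destruct Rcase_abs; lra.
Qed.

(** At [rho - d] and [rho + d] the truncations eventually have the signs of the limit; their own
    sign pattern then traps the root between the two points. *)
Lemma trunc_root_lim a b k rho (r : nat -> R) :
  is_root_in a b ones k rho ->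
  eventually (fun n => is_root_in a b (trunc n) k (r n)) ->
  is_lim_seq r rho.
Proof.
  intros [Hrho [_ Hs]] [N0 Hr]; apply is_lim_seq_spec; intros eps.
  set (d := Rmin eps (Rmin (rho - root_lo k) (root_hi k - rho)) / 2).
  assert (Hd : 0 < d /\ d < eps /\ root_lo k < rho - d /\ rho + d < root_hi k).
  { pose proof (cond_pos eps) as He.
    unfold d, Rmin; repeat destruct Rle_dec; lra. }
  destruct (Hs (rho - d) ltac:(lra)) as [S1 _].
  destruct (Hs (rho + d) ltac:(lra)) as [_ S2].
  assert (L1 : forall x, is_lim_seq (fun n => root_sign k * wpsi a b (trunc n) x)
                 (root_sign k * wpsi a b ones x)).
  { intros x; apply is_lim_seq_mult'; [apply is_lim_seq_const|apply wpsi_trunc_lim]. }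
  destruct (is_lim_seq_eventually_pos _ _ (L1 (rho - d)) ltac:(lra)) as [N1 HN1].
  destruct (is_lim_seq_eventually_pos _ _
    (proj1 (is_lim_seq_opp _ _) (L1 (rho + d))) ltac:(lra)) as [N2 HN2].
  exists (N0 + N1 + N2)%nat; intros n Hn.
  specialize (HN1 n ltac:(lia)); specialize (HN2 n ltac:(lia)).
  destruct (Hr n ltac:(lia)) as [_ [E H]].
  destruct (H (rho - d) ltac:(lra)) as [_ A1].
  destruct (H (rho + d) ltac:(lra)) as [A2 _].
  assert (rho - d < r n).
  { destruct (Rtotal_order (rho - d) (r n)) as [T|[T|T]]; [exact T| |].
    - rewrite T, E in HN1; lra.
    - specialize (A1 T); lra. }
  assert (r n < rho + d).
  { destruct (Rtotal_order (r n) (rho + d)) as [T|[T|T]]; [exact T| |].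
    - rewrite <- T, E in HN2; lra.
    - specialize (A2 T); lra. }
  unfold Rabs; destruct Rcase_abs; lra.
Qed.

Lemma ex_series_inv_cube : ex_series (fun k => / INR (S k) ^ 3).
Proof.
  apply (ex_series_le (V := R_CompleteNormedModule) _ (fun k => / INR (S k) ^ 2));
    [|apply ex_series_inv_sq].
  intros k; change norm with Rabs; apply Rinv_pow_le_sq; [|lia].
  pose proof (INR_S_ge1 k); lra.
Qed.

Lemma wpsi_root_series a b rho :
  0 < a -> a < b - 1 -> b <= 2 ->
  (forall k, is_root_in a b ones k (rho k)) ->
  let a1 := a + b - 1 in
  let a2 := - b - PI ^ 2 / 6 in
  let z3 := Series (fun k => / INR (S k) ^ 3) in
  is_series (fun k => (/ (rho k + 1)) ^ 4)
    (PI ^ 4 / 90 + (a1 ^ 4 - 4 * a1 ^ 2 * a2 + 4 * a1 * (PI ^ 2 / 6 + z3)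
      + 2 * a2 ^ 2 - 4 * (- z3 - PI ^ 4 / 90))).
Proof.
  intros Ha Hab Hb Hrho a1 a2 z3.
  set (r := fun n k => epsilon (inhabits 0) (is_root_in a b (trunc n) k)).
  (* [n >= 7] makes the first eight weights 1, as [wpsi_large_pos] requires, and [k < n + 2] keeps
     the poles around the root within the truncation. *)
  assert (Hr : forall n k, (7 <= n)%nat -> (k < n + 2)%nat ->
             is_root_in a b (trunc n) k (r n k)).
  { intros n k Hn Hk; unfold r; apply epsilon_spec.
    apply wpsi_root; auto; [apply trunc_weight| |];
      intros m Hm; apply trunc_1; lia. }
  assert (Hlim : forall k, is_lim_seq (fun n => r n k) (rho k)).
  { intros k; apply (trunc_root_lim a b k); [apply Hrho|].
    exists (7 + k)%nat; intros n Hn; apply Hr; lia. }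
  assert (Hne : forall k x, root_lo k < x < root_hi k -> x + 1 <> 0).
  { intros k x Hx; pose proof (root_interval_no_pole k x Hx O) as H.
    simpl in H; lra. }
  assert (Hlim4 : forall k,
    is_lim_seq (fun n => (/ (r n k + 1)) ^ 4) ((/ (rho k + 1)) ^ 4)).
  { intros k; rewrite pow_inv.
    apply (is_lim_seq_ext (fun n => / (r n k + 1) ^ 4));
      [intros; symmetry; apply pow_inv|].
    apply is_lim_seq_inv_pow; [apply (Hne k), Hrho|].
    apply is_lim_seq_plus'; [apply Hlim|apply is_lim_seq_const]. }
  (* Root 2 lies between the poles [z = -1] and [z = 0], so its interval gives no bound on
     [1 / z^4]; its convergence does. Roots 0 and 1 have [z > 1], and root [j + 3] has
     [|z| > j + 1]. *)
  set (B := (/ (rho 2%nat + 1)) ^ 4 + 1).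
  assert (HB : 1 <= B).
  { assert (0 <= (/ (rho 2%nat + 1)) ^ 4); [|unfold B; lra].
    replace 4%nat with (2 * 2)%nat by reflexivity; rewrite pow_mult.
    apply pow2_ge_0. }
  set (M := fun k => match k with S (S (S j)) => / INR (S j) ^ 2 | _ => B end).
  apply (tannery (fun n k => (/ (r n k + 1)) ^ 4) _ M (fun n => (n + 2)%nat)).
  - exact Hlim4.
  - apply (ex_series_incr_n M 3).
    apply (ex_series_ext (fun k => / INR (S k) ^ 2)); [reflexivity|].
    apply ex_series_inv_sq.
  - pose proof (Hlim4 2%nat) as H2; apply is_lim_seq_spec in H2.
    destruct (H2 (mkposreal 1 Rlt_0_1)) as [N HN]; simpl pos in HN.
    exists (7 + N)%nat; intros n Hn k Hk.
    specialize (HN n ltac:(lia)).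
    destruct (Hr n k ltac:(lia) Hk) as [Hi _].
    rewrite <- RPow_abs, Rabs_inv, pow_inv.
    destruct k as [|[|[|j]]]; cbn [root_lo root_hi] in Hi; unfold M.
    + rewrite Rabs_pos_eq by lra.
      apply Rle_trans with (/ 1); [|lra].
      apply Rinv_le_contravar; [lra|].
      apply (pow_R1_Rle (r n 0%nat + 1) 4); lra.
    + rewrite Rabs_pos_eq by lra.
      apply Rle_trans with (/ 1); [|lra].
      apply Rinv_le_contravar; [lra|].
      apply (pow_R1_Rle (r n 1%nat + 1) 4); lra.
    + rewrite <- pow_inv, <- Rabs_inv, RPow_abs.
      unfold B; pose proof (Rabs_pos ((/ (rho 2%nat + 1)) ^ 4)).
      replace 4%nat with (2 * 2)%nat in * by reflexivity; rewrite !pow_mult in *.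
      rewrite Rabs_pos_eq by apply pow2_ge_0.
      revert HN; unfold Rabs at 1; destruct Rcase_abs; lra.
    + apply Rle_trans with (Rabs (/ Rabs (r n (S (S (S j))) + 1) ^ 4)).
      { apply Rle_abs. }
      apply Rinv_pow_le_sq; [|lia].
      split; [apply INR_S_ge1|].
      rewrite (S_INR (S j)) in Hi; rewrite Rabs_left; [lra|].
      pose proof (INR_S_ge1 j); lra.
  - intros K; exists K; intros; lia.
  - apply (is_lim_seq_ext_loc (fun n => psum (fun m => / INR (S m) ^ 4) n
      + (laurent1 a b n ^ 4 - 4 * laurent1 a b n ^ 2 * laurent2 b n
         + 4 * laurent1 a b n * laurent3 n + 2 * laurent2 b n ^ 2
         - 4 * laurent4 n))).
    { exists 7%nat; intros n Hn; symmetry; apply trunc_root_power_sum.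
      intros; apply Hr; assumption. }
    pose proof (proj1 (is_series_psum _ _) is_series_inv_pow4) as Z4.
    pose proof (proj1 (is_series_psum _ _) is_series_inv_sq) as Z2.
    pose proof (proj1 (is_series_psum _ _) is_series_telescope) as Z1.
    pose proof (proj1 (is_series_psum _ _)
      (Series_correct _ ex_series_inv_cube)) as Z3; fold z3 in Z3.
    assert (L1 : is_lim_seq (laurent1 a b) a1).
    { replace a1 with (a + b - 2 + 1) by (unfold a1; ring).
      apply is_lim_seq_plus'; [apply is_lim_seq_const|exact Z1]. }
    assert (L2 : is_lim_seq (laurent2 b) a2).
    { replace a2 with (1 - b - PI ^ 2 / 6 - 1) by (unfold a2; ring).
      apply is_lim_seq_minus'; [|exact Z1].
      apply is_lim_seq_minus'; [apply is_lim_seq_const|exact Z2]. }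
    assert (L3 : is_lim_seq laurent3 (PI ^ 2 / 6 + z3)).
    { apply is_lim_seq_plus'; assumption. }
    assert (L4 : is_lim_seq laurent4 (- z3 - PI ^ 4 / 90)).
    { apply is_lim_seq_minus'; [|exact Z4].
      apply (is_lim_seq_opp _ z3), Z3. }
    assert (Lpow : forall u (l : R) p, is_lim_seq u l -> is_lim_seq (fun n => u n ^ p) (l ^ p)).
    { intros u l p Hu; induction p as [|p IH]; simpl; [apply is_lim_seq_const|].
      apply is_lim_seq_mult'; assumption. }
    repeat first [exact Z4 | exact L1 | exact L2 | exact L3 | exact L4
      | apply is_lim_seq_const | apply Lpow | apply is_lim_seq_minus'
      | apply is_lim_seq_plus' | apply is_lim_seq_mult'].
Qed.

(** * The Barnes function on the real line *)

Definition rfactor (w : R) (m : nat) : R :=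
  (1 + w / INR (S m)) ^ S m * exp (w * w / (2 * INR (S m)) - w).

Fixpoint rprod (w : R) (n : nat) : R :=
  match n with O => 1 | S m => rprod w m * rfactor w m end.

Definition rbarnes (x : R) : R :=
  exp ((x - 1) / 2 * ln (2 * PI))
  * exp (- ((x - 1 + (x - 1) * (x - 1) * (1 + euler_gamma)) / 2))
  * real (Lim_seq (rprod (x - 1))).

Lemma Cexp_RtoC x : Cexp (RtoC x) = RtoC (exp x).
Proof.
  unfold Cexp; simpl; rewrite cos_0, sin_0, Rmult_1_r, Rmult_0_r; reflexivity.
Qed.

Lemma barnes_factor_RtoC w m : barnes_factor (RtoC w) m = RtoC (rfactor w m).
Proof.
  pose proof (INR_S_ge1 m); unfold barnes_factor, rfactor.
  rewrite <- !RtoC_mult, <- !RtoC_div, <- RtoC_plus, <- RtoC_minus by lra.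
  rewrite <- RtoC_pow, Cexp_RtoC, <- RtoC_mult; reflexivity.
Qed.

Lemma Cprod_RtoC w n : Cprod (barnes_factor (RtoC w)) n = RtoC (rprod w n).
Proof.
  induction n as [|n IH]; simpl Cprod; simpl rprod; [reflexivity|].
  rewrite IH, barnes_factor_RtoC, <- RtoC_mult; reflexivity.
Qed.

Lemma barnesG_RtoC x : barnesG (RtoC x) = RtoC (rbarnes x).
Proof.
  unfold barnesG, rbarnes, CLim_seq.
  rewrite <- RtoC_minus.
  rewrite (Lim_seq_ext _ (rprod (x - 1))) by (intros; rewrite Cprod_RtoC; reflexivity).
  rewrite (Lim_seq_ext (fun n => Im _) (fun _ => 0))
    by (intros; rewrite Cprod_RtoC; reflexivity).
  rewrite Lim_seq_const.
  change (real (Lim_seq (rprod (x - 1))), real 0)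
    with (RtoC (real (Lim_seq (rprod (x - 1))))).
  rewrite <- RtoC_div by lra.
  rewrite <- !RtoC_plus, <- !RtoC_mult, <- !RtoC_plus, <- RtoC_div by lra.
  rewrite <- RtoC_opp, !Cexp_RtoC, <- !RtoC_mult; reflexivity.
Qed.

(** * Termwise differentiation of the Weierstrass product *)

Lemma weierstrass_tail (f An : nat -> R) n :
  (forall i, Rabs (f i) <= An i) -> ex_series An ->
  Rabs (Series f - psum f n) <= Series An - psum An n.
Proof.
  intros Hf HA.
  assert (Ef : ex_series f) by (apply (ex_series_le (V := R_CompleteNormedModule) f An); auto).
  pose proof (proj1 (is_series_psum _ _) (Series_correct _ Ef)) as Lf.
  pose proof (proj1 (is_series_psum _ _) (Series_correct _ HA)) as LA.
  apply (is_lim_seq_le_loc (fun m => Rabs (psum f m - psum f n))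
           (fun m => psum An m - psum An n)
           (Rabs (Series f - psum f n)) (Series An - psum An n)).
  - exists n; intros m Hm; apply psum_tail_le; auto.
  - apply (is_lim_seq_abs _ (Series f - psum f n)).
    apply is_lim_seq_minus'; [exact Lf|apply is_lim_seq_const].
  - apply is_lim_seq_minus'; [exact LA|apply is_lim_seq_const].
Qed.

(** The logarithm of [rfactor] where [1 + w / k > 0]. Its derivative [k / (k + w) + w / k - 1] is
    the summand [w^2 / (k (k + w))] of [psi_G]. *)
Definition log_factor (m : nat) (w : R) : R :=
  INR (S m) * ln (1 + w / INR (S m)) + w * w / (2 * INR (S m)) - w.

Lemma half_bound_pos w m : 2 * Rabs w <= INR (S m) ->
  0 < 1 + w / INR (S m) /\ 0 < INR (S m) + w.
Proof.
  intros H; pose proof (INR_S_ge1 m).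
  assert (0 < INR (S m) + w) by (revert H; unfold Rabs; destruct Rcase_abs; lra).
  split; [|lra].
  replace (1 + w / INR (S m)) with ((INR (S m) + w) / INR (S m)) by (field; lra).
  apply Rdiv_lt_0_compat; lra.
Qed.

Lemma rfactor_exp w m : 2 * Rabs w <= INR (S m) -> rfactor w m = exp (log_factor m w).
Proof.
  intros H; unfold rfactor, log_factor, Rminus; destruct (half_bound_pos w m H) as [H1 _].
  rewrite Rplus_assoc, (exp_plus (INR (S m) * _)); f_equal.
  rewrite <- Rpower_pow by exact H1; reflexivity.
Qed.

Lemma log_factor_derive w m : 2 * Rabs w <= INR (S m) ->
  is_derive (log_factor m) w (w ^ 2 * pole_term w m).
Proof.
  intros H; destruct (half_bound_pos w m H) as [H1 H2].
  pose proof (INR_S_ge1 m); unfold log_factor, pole_term.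
  set (k := INR (S m)) in *; auto_derive; [exact H1|].
  field; repeat split; lra.
Qed.

(** [log_factor m] vanishes at 0, so the mean value theorem carries the bound on its derivative over
    to it. *)
Lemma log_factor_bound w m R : 2 * R <= INR (S m) -> Rabs w <= R ->
  Rabs (log_factor m w) <= R * (R ^ 2 * (2 * / INR (S m) ^ 2)).
Proof.
  intros HR Hw.
  destruct (MVT_gen (log_factor m) 0 w (fun v => v ^ 2 * pole_term v m)) as [v [Hv E]].
  - intros v Hv; apply log_factor_derive.
    assert (Rabs v <= R); [|lra].
    revert Hw Hv; unfold Rmin, Rmax, Rabs; destruct Rle_dec; repeat destruct Rcase_abs; lra.
  - intros v Hv; apply derivable_continuous_pt, ex_derive_Reals_0.
    eexists; apply log_factor_derive.
    assert (Rabs v <= R); [|lra].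
    revert Hw Hv; unfold Rmin, Rmax, Rabs; destruct Rle_dec; repeat destruct Rcase_abs; lra.
  - assert (Hv' : Rabs v <= R).
    { revert Hw Hv; unfold Rmin, Rmax, Rabs; destruct Rle_dec; repeat destruct Rcase_abs; lra. }
    pose proof (INR_S_ge1 m).
    assert (E0 : log_factor m 0 = 0).
    { unfold log_factor; replace (1 + 0 / INR (S m)) with 1 by (field; lra).
      rewrite ln_1; field; lra. }
    rewrite E0, !Rminus_0_r in E; rewrite E, !Rabs_mult.
    rewrite (Rmult_comm R); pose proof (Rabs_pos v).
    apply Rmult_le_compat; [apply Rmult_le_pos; apply Rabs_pos|apply Rabs_pos| |exact Hw].
    apply Rmult_le_compat; try apply Rabs_pos.
    + rewrite <- RPow_abs; apply pow_incr; lra.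
    + apply pole_term_abs_le; lra.
Qed.

Lemma ex_series_scal_inv_sq C M : ex_series (fun i => C * / INR (S (M + i)) ^ 2).
Proof.
  destruct ex_series_inv_sq as [l Hl].
  assert (E : ex_series (fun i => C * / INR (S i) ^ 2)).
  { exists (C * l); apply (is_series_scal C _ l), Hl. }
  exact (proj1 (ex_series_incr_n (fun i => C * / INR (S i) ^ 2) M) E).
Qed.

Lemma INR_S_plus_ge M i : INR (S M) <= INR (S (M + i)).
Proof. apply le_INR; lia. Qed.

Lemma ex_series_log_factor M w : 2 * Rabs w <= INR (S M) ->
  ex_series (fun i => log_factor (M + i) w).
Proof.
  intros H.
  apply (ex_series_le (V := R_CompleteNormedModule) _
    (fun i => Rabs w * Rabs w ^ 2 * 2 * / INR (S (M + i)) ^ 2));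
    [|apply ex_series_scal_inv_sq].
  intros i; change norm with Rabs; rewrite !Rmult_assoc.
  apply log_factor_bound; [|lra].
  pose proof (INR_S_plus_ge M i); lra.
Qed.

(** On the ball of radius [(M + 1) / 2] about 0 the derivatives are dominated by multiples of
    [1 / k^2], hence converge uniformly; the strict hypothesis puts [w] inside. *)
Lemma log_factor_series_derive M w : 2 * Rabs w < INR (S M) ->
  is_derive (fun y => Series (fun i => log_factor (M + i) y)) w
    (w ^ 2 * Series (fun i => pole_term w (M + i))).
Proof.
  intros Hw; set (B := INR (S M) / 2).
  assert (HB : 0 < B) by (pose proof (INR_S_ge1 M); unfold B; lra).
  assert (Hin : forall y i, Rabs y <= B -> 2 * Rabs y <= INR (S (M + i))).
  { intros y i Hy; pose proof (INR_S_plus_ge M i); unfold B in Hy; lra. }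
  apply is_derive_Reals.
  apply (Ranalysis5.derivable_pt_lim_CVU
    (fun n y => psum (fun i => log_factor (M + i) y) n)
    (fun n y => psum (fun i => y ^ 2 * pole_term y (M + i)) n)
    _ (fun y => y ^ 2 * Series (fun i => pole_term y (M + i)))
    w 0 (mkposreal B HB)); unfold Boule; cbn [pos].
  - rewrite Rminus_0_r; unfold B; lra.
  - intros y n Hy; rewrite Rminus_0_r in Hy; apply is_derive_Reals.
    induction n as [|n IH]; cbn [psum]; [apply (is_derive_const (V := R_NormedModule))|].
    apply (is_derive_plus (V := R_NormedModule)); [exact IH|].
    apply log_factor_derive, Hin; lra.
  - intros y Hy; rewrite Rminus_0_r in Hy; apply is_lim_seq_Reals.
    apply is_series_psum, Series_correct, ex_series_log_factor.
    unfold B in Hy; lra.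
  - intros eps Heps.
    set (An := fun i => B ^ 2 * 2 * / INR (S (M + i)) ^ 2).
    assert (HA : ex_series An) by apply ex_series_scal_inv_sq.
    pose proof (proj1 (is_series_psum _ _) (Series_correct _ HA)) as LA.
    apply is_lim_seq_spec in LA; destruct (LA (mkposreal eps Heps)) as [N HN].
    exists N; intros n y Hn Hy; specialize (HN n Hn); simpl pos in HN.
    unfold Boule in Hy; cbn [pos] in Hy; rewrite Rminus_0_r in Hy.
    rewrite <- Series_scal_l.
    eapply Rle_lt_trans; [apply (weierstrass_tail _ An)|].
    + intros i; unfold An; rewrite Rabs_mult, Rmult_assoc.
      apply Rmult_le_compat; try apply Rabs_pos.
      * rewrite <- RPow_abs; apply pow_incr; split; [apply Rabs_pos|lra].
      * apply pole_term_abs_le, Hin; lra.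
    + exact HA.
    + revert HN; unfold Rabs; destruct Rcase_abs; lra.
  - intros y Hy; rewrite Rminus_0_r in Hy.
    apply continuity_pt_mult; [reg|].
    assert (Hy' : - INR M - 1 / 2 < y).
    { rewrite S_INR in *; pose proof (pos_INR M); unfold B in Hy.
      revert Hy; rewrite S_INR; unfold Rabs; destruct Rcase_abs; lra. }
    eapply continuity_pt_ext; [|apply (pole_tail_continuity ones M y ones_weight Hy')].
    intros v; cbv beta; apply Series_ext; intros i; unfold ones; ring.
Qed.

Lemma rfactor_neq_0 w m : no_pole w -> rfactor w m <> 0.
Proof.
  intros Hw; unfold rfactor; pose proof (INR_S_ge1 m); specialize (Hw m).
  apply Rmult_integral_contrapositive_currified.
  - apply pow_nonzero; intros E; apply Hw.
    replace (INR (S m) + w) with (INR (S m) * (1 + w / INR (S m))) by (field; lra).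
    rewrite E; ring.
  - pose proof (exp_pos (w * w / (2 * INR (S m)) - w)); lra.
Qed.

Lemma rprod_neq_0 w n : no_pole w -> rprod w n <> 0.
Proof.
  intros Hw; induction n as [|n IH]; cbn [rprod]; [lra|].
  apply Rmult_integral_contrapositive_currified; [exact IH|apply rfactor_neq_0, Hw].
Qed.

Lemma rprod_derive w n : no_pole w ->
  is_derive (fun y => rprod y n) w (rprod w n * (w ^ 2 * psum (pole_term w) n)).
Proof.
  intros Hw; induction n as [|n IH]; cbn [rprod psum].
  - replace (1 * _) with 0 by ring; apply (is_derive_const (V := R_NormedModule)).
  - assert (D : is_derive (fun y => rfactor y n) w (rfactor w n * (w ^ 2 * pole_term w n))).
    { pose proof (INR_S_ge1 n); specialize (Hw n); unfold rfactor, pole_term.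
      assert (Hk : INR (S n) = match n with O => 1 | S _ => INR n + 1 end) by reflexivity.
      auto_derive; [exact I|].
      rewrite <- Hk; clear Hk; cbn [pow Init.Nat.pred].
      set (k := INR (S n)) in *; unfold Rdiv, Rminus.
      set (p := _ ^ n); set (e := exp _); field; lra. }
    replace (rprod w n * rfactor w n * (w ^ 2 * (psum (pole_term w) n + pole_term w n)))
      with (rprod w n * (w ^ 2 * psum (pole_term w) n) * rfactor w n
            + rprod w n * (rfactor w n * (w ^ 2 * pole_term w n))) by ring.
    apply (is_derive_mult (fun y => rprod y n) (fun y => rfactor y n) w _ _ IH D).
    intros; apply Rmult_comm.
Qed.

Lemma rprod_tail w M n : 2 * Rabs w <= INR (S M) ->
  rprod w (M + n) = rprod w M * exp (psum (fun i => log_factor (M + i) w) n).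
Proof.
  intros H; induction n as [|n IH].
  - rewrite Nat.add_0_r; simpl; rewrite exp_0; ring.
  - rewrite Nat.add_succ_r; cbn [rprod psum]; rewrite IH, exp_plus, rfactor_exp; [ring|].
    pose proof (INR_S_plus_ge M n); lra.
Qed.

Lemma rprod_lim w M : 2 * Rabs w <= INR (S M) ->
  is_lim_seq (rprod w) (rprod w M * exp (Series (fun i => log_factor (M + i) w))).
Proof.
  intros H; apply (is_lim_seq_incr_n _ M).
  apply (is_lim_seq_ext (fun n => rprod w M * exp (psum (fun i => log_factor (M + i) w) n))).
  { intros n; rewrite <- rprod_tail by exact H; f_equal; lia. }
  apply is_lim_seq_mult'; [apply is_lim_seq_const|].
  apply (is_lim_seq_continuous exp); [apply derivable_continuous_pt, derivable_pt_exp|].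
  apply is_series_psum, Series_correct, ex_series_log_factor, H.
Qed.

(** The first factors may be negative, so logarithms serve only for the tail; the finite product
    before it is differentiated directly. *)
Lemma rprod_lim_derive w : no_pole w ->
  let P := fun y => real (Lim_seq (rprod y)) in
  P w <> 0 /\
  is_derive P w (P w * (w ^ 2 * Series (fun m => ones m * pole_term w m))).
Proof.
  (* The added 1 makes [2 |y| <= M + 1] hold for all [y] within distance 1 of [w], as a derivative
     needs a neighbourhood. *)
  intros Hw P; destruct (nfloor_ex (2 * (Rabs w + 1))) as [M [_ HM]];
    [pose proof (Rabs_pos w); lra|].
  rewrite <- S_INR in HM.
  set (Q := fun y => rprod y M * exp (Series (fun i => log_factor (M + i) y))).
  assert (HQ : forall y, 2 * Rabs y <= INR (S M) -> Q y = P y).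
  { intros y Hy; unfold P, Q.
    rewrite (is_lim_seq_unique _ _ (rprod_lim y M Hy)); reflexivity. }
  assert (Hw2 : 2 * Rabs w < INR (S M)) by lra.
  rewrite <- (HQ w) by lra; split.
  - unfold Q; apply Rmult_integral_contrapositive_currified; [apply rprod_neq_0, Hw|].
    match goal with |- exp ?t <> 0 => pose proof (exp_pos t); lra end.
  - apply (is_derive_ext_loc Q).
    { exists (mkposreal 1 Rlt_0_1); intros y Hy; apply HQ.
      change (Rabs (y - w) < 1) in Hy.
      revert Hy HM; unfold Rabs; repeat destruct Rcase_abs; lra. }
    rewrite (Series_psum_split _ M (ex_series_pole ones w ones_weight)).
    rewrite (psum_ext _ (pole_term w)) by (intros; unfold ones; ring).
    rewrite (Series_ext _ (fun i => pole_term w (M + i))) by (intros; unfold ones; ring).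
    pose proof (rprod_derive w M Hw) as D1.
    pose proof (log_factor_series_derive M w Hw2) as D2.
    assert (D3 : is_derive (fun y => exp (Series (fun i => log_factor (M + i) y))) w
      (w ^ 2 * Series (fun i => pole_term w (M + i))
       * exp (Series (fun i => log_factor (M + i) w)))).
    { apply (is_derive_comp exp); [|exact D2].
      apply is_derive_Reals, derivable_pt_lim_exp. }
    unfold Q at 2.
    replace (_ * (w ^ 2 * _)) with
      (rprod w M * (w ^ 2 * psum (pole_term w) M)
         * exp (Series (fun i => log_factor (M + i) w))
       + rprod w M * (w ^ 2 * Series (fun i => pole_term w (M + i))
         * exp (Series (fun i => log_factor (M + i) w)))) by ring.
    apply (is_derive_mult _ _ _ _ _ D1 D3); intros; apply Rmult_comm.
Qed.

(** The two exponential prefactors have logarithmic derivative [L / 2 - 1 / 2 - (1 + gamma) w], the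
    affine part of [wpsi]; the product gives the series. *)
Lemma rbarnes_derive x : no_pole (x - 1) ->
  rbarnes x <> 0 /\
  is_derive rbarnes x
    (rbarnes x * wpsi ((ln (2 * PI) - 1) / 2) (1 + euler_gamma) ones (x - 1)).
Proof.
  intros Hx; destruct (rprod_lim_derive (x - 1) Hx) as [H0 HD]; cbv zeta in *.
  set (P := fun y => real (Lim_seq (rprod y))) in *.
  set (s := Series (fun m => ones m * pole_term (x - 1) m)) in *.
  set (E := fun y => exp ((y - 1) / 2 * ln (2 * PI))
    * exp (- ((y - 1 + (y - 1) * (y - 1) * (1 + euler_gamma)) / 2))).
  change rbarnes with (fun y => E y * P (y - 1)).
  split.
  - apply Rmult_integral_contrapositive_currified; [|exact H0].
    unfold E; rewrite <- exp_plus; apply Rgt_not_eq, exp_pos.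
  - unfold wpsi; fold s.
    replace (E x * P (x - 1) * _) with
      (E x * (ln (2 * PI) / 2 - (1 + 2 * (x - 1) * (1 + euler_gamma)) / 2) * P (x - 1)
       + E x * (1 * (P (x - 1) * ((x - 1) ^ 2 * s)))) by field.
    apply (is_derive_mult E (fun y => P (y - 1))); [| |intros; apply Rmult_comm].
    + unfold E; auto_derive; [exact I|]; unfold Rdiv, Rminus.
      set (e1 := exp _); set (e2 := exp _); set (l := ln _); field.
    + apply (is_derive_comp P (fun y => y - 1)); [exact HD|auto_derive; [exact I|ring]].
Qed.

Lemma is_derive_is_lim f x l : is_derive f x l ->
  is_lim (fun t => (f t - f x) / (t - x)) x l.
Proof.
  intros H; apply is_derive_Reals in H; apply is_lim_spec; intros eps.
  destruct (H eps (cond_pos eps)) as [d Hd].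
  exists d; intros t Ht Htx; change (Rabs (t - x) < d) in Ht.
  specialize (Hd (t - x) ltac:(lra) Ht).
  rewrite Rplus_minus in Hd; exact Hd.
Qed.

Lemma psi_G_RtoC x : no_pole (x - 1) ->
  psi_G (RtoC x) =
  RtoC (wpsi ((ln (2 * PI) - 1) / 2) (1 + euler_gamma) ones (x - 1)).
Proof.
  intros Hx; destruct (rbarnes_derive x Hx) as [H0 HD].
  set (l := wpsi _ _ _ _) in *.
  assert (Hq : forall t, t <> x ->
    ((barnesG (t, 0) - barnesG (RtoC x)) / ((t, 0) - RtoC x))%C
    = RtoC ((rbarnes t - rbarnes x) / (t - x))).
  { intros t Ht; change (t, 0) with (RtoC t); rewrite !barnesG_RtoC.
    rewrite <- !RtoC_minus, <- RtoC_div by lra; reflexivity. }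
  assert (E : C_derive barnesG (RtoC x) = RtoC (rbarnes x * l)).
  { unfold C_derive, C_lim, RtoC at 5 10; cbn [fst snd].
    unfold RtoC; f_equal.
    - rewrite (is_lim_unique _ _ (rbarnes x * l)); [reflexivity|].
      apply (is_lim_ext_loc (fun t => (rbarnes t - rbarnes x) / (t - x)));
        [|apply is_derive_is_lim, HD].
      exists (mkposreal 1 Rlt_0_1); intros t _ Ht.
      symmetry; exact (f_equal fst (Hq t Ht)).
    - rewrite (is_lim_unique _ _ 0); [reflexivity|].
      apply (is_lim_ext_loc (fun t => 0)); [|apply is_lim_const].
      exists (mkposreal 1 Rlt_0_1); intros t _ Ht.
      symmetry; exact (f_equal snd (Hq t Ht)). }
  unfold psi_G; rewrite E, barnesG_RtoC, <- RtoC_div by exact H0.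
  f_equal; field; exact H0.
Qed.

(** * Bounds on the constants *)

(** The difference of the sides has derivative [(1 - 1 / t)^2 / 2]. At [y = (k + 1) / k] this is the
    trapezoid bound [(1 / k + 1 / (k + 1)) / 2], sharp enough for [gamma >= 1/2]. *)
Lemma ln_le_half_sub_inv y : 1 <= y -> ln y <= (y - / y) / 2.
Proof.
  intros Hy.
  destruct (MVT_gen (fun t => (t - / t) / 2 - ln t) 1 y
              (fun t => (1 - / t) ^ 2 / 2)) as [t [Ht E]].
  - rewrite Rmin_left, Rmax_right by lra; intros t Ht.
    auto_derive; [lra|field; lra].
  - rewrite Rmin_left, Rmax_right by lra; intros t Ht.
    apply derivable_continuous_pt, ex_derive_Reals_0; auto_derive; lra.
  - rewrite Rinv_1, ln_1 in E.
    assert (0 <= (1 - / t) ^ 2 / 2 * (y - 1)); [|lra].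
    apply Rmult_le_pos; [|lra].
    pose proof (pow2_ge_0 (1 - / t)); lra.
Qed.

Lemma ln_ge_sub_inv y : 0 < y -> 1 - / y <= ln y.
Proof.
  intros Hy; pose proof (exp_ineq1_le (- ln y)) as H.
  rewrite exp_Ropp, exp_ln in H by exact Hy; lra.
Qed.

Lemma euler_gamma_bounds : 1 / 2 <= euler_gamma <= 1.
Proof.
  set (u := fun n => sum_n (fun k => / INR (S k)) n - ln (INR (S n))).
  assert (U0 : u O = 1) by (unfold u; rewrite sum_O; simpl; rewrite ln_1; field).
  assert (Step : forall n, u (S n) <= u n /\
    u n + (/ INR (S (S n)) - / INR (S n)) / 2 <= u (S n)).
  { intros n; unfold u; rewrite sum_Sn; change plus with Rplus.
    pose proof (INR_S_ge1 n); rewrite (S_INR (S n)).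
    set (k := INR (S n)) in *.
    assert (Hy : 0 < (k + 1) / k) by (apply Rdiv_lt_0_compat; lra).
    assert (L : ln (k + 1) = ln k + ln ((k + 1) / k))
      by (rewrite ln_div by lra; ring).
    pose proof (ln_ge_sub_inv _ Hy) as L1.
    replace (1 - / ((k + 1) / k)) with (/ (k + 1)) in L1 by (field; lra).
    assert (L2 : ln ((k + 1) / k) <= ((k + 1) / k - / ((k + 1) / k)) / 2).
    { apply ln_le_half_sub_inv, Rle_div_r; lra. }
    replace (((k + 1) / k - / ((k + 1) / k)) / 2) with ((/ k + / (k + 1)) / 2) in L2
      by (field; lra).
    lra. }
  (* By [Step], [u n - 1 / (2 (n + 1))] is nondecreasing, and it starts at [1 / 2]. *)
  assert (Low : forall n, 1 / 2 + / INR (S n) / 2 <= u n).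
  { induction n as [|n IH]; [simpl (INR 1); lra|].
    destruct (Step n); lra. }
  assert (Low' : forall n, 1 / 2 <= u n).
  { intros n; specialize (Low n).
    pose proof (Rinv_0_lt_compat _ (INR_S_pos n)); lra. }
  assert (High : forall n, u n <= 1).
  { induction n as [|n IH]; [lra|]; destruct (Step n); lra. }
  destruct (ex_finite_lim_seq_decr u (1 / 2)) as [l Hl];
    [intros; apply Step|exact Low'|].
  unfold euler_gamma; fold u; rewrite (is_lim_seq_unique _ _ Hl); simpl.
  split.
  - apply (is_lim_seq_le (fun _ => 1 / 2) u (1 / 2) l);
      [exact Low'|apply is_lim_seq_const|exact Hl].
  - apply (is_lim_seq_le u (fun _ => 1) l 1);
      [exact High|exact Hl|apply is_lim_seq_const].
Qed.

Lemma ln_2PI_bounds : 1 < ln (2 * PI) < 2.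
Proof.
  pose proof PI_gt_3; pose proof PI_upper; pose proof exp_le_3.
  split; apply exp_lt_inv; rewrite exp_ln by lra; [lra|].
  (* [2 PI < 7], while this power is about 7.17 and at most [exp (1 / 32) ^ 64]. *)
  apply Rlt_le_trans with ((1 + / 32) ^ 64); [lra|].
  replace (exp 2) with (exp (/ 32) ^ 64).
  - apply pow_incr; pose proof (exp_ineq1_le (/ 32)); lra.
  - rewrite <- Rpower_pow by apply exp_pos; unfold Rpower; rewrite ln_exp.
    f_equal; simpl; field.
Qed.

Lemma zeta_3 : zeta 3 = Series (fun k => / INR (S k) ^ 3).
Proof.
  unfold zeta; apply Series_ext; intros n; f_equal.
  rewrite <- Rpower_pow by apply INR_S_pos; f_equal; simpl; ring.
Qed.

(** * Decreasing enumerations *)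

(** If [f n = g m] with [m < n], then [f n = f m] contradicts the decrease of [f]; hence
    [m >= n]. *)
Lemma decreasing_enum_le (f g : nat -> R) n :
  (forall k, g (S k) < g k) -> (forall k, exists m, f k = g m) ->
  (forall j k, (j < k)%nat -> f k < f j) ->
  (forall j, (j < n)%nat -> f j = g j) -> f n <= g n.
Proof.
  intros Hg Hr Hf Hj; destruct (Hr n) as [m Hm].
  destruct (Nat.le_gt_cases n m) as [H|H].
  - rewrite Hm; clear - Hg H; induction H as [|m H IH]; [lra|].
    specialize (Hg m); lra.
  - specialize (Hj m H); specialize (Hf m n H); lra.
Qed.

Lemma decreasing_lt (f : nat -> R) :
  (forall k, f (S k) < f k) -> forall j k, (j < k)%nat -> f k < f j.
Proof.
  intros Hf j k H; induction H as [|k H IH]; [apply Hf|].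
  specialize (Hf k); lra.
Qed.

Lemma decreasing_enum_unique (f g : nat -> R) :
  (forall k, f (S k) < f k) -> (forall k, g (S k) < g k) ->
  (forall k, exists m, f k = g m) -> (forall k, exists m, g k = f m) ->
  forall k, f k = g k.
Proof.
  intros Hf Hg Hfg Hgf k.
  induction k as [k IH] using (well_founded_induction Nat.lt_wf_0).
  apply Rle_antisym.
  - apply decreasing_enum_le; auto; apply decreasing_lt, Hf.
  - apply decreasing_enum_le; auto; [apply decreasing_lt, Hg|].
    intros; symmetry; auto.
Qed.

(** * Real zeros of [psi_G] and the value of the sum *)

Lemma is_zero_psi_G_RtoC x :
  is_zero_psi_G (RtoC x) <->
  no_pole (x - 1) /\
  wpsi ((ln (2 * PI) - 1) / 2) (1 + euler_gamma) ones (x - 1) = 0.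
Proof.
  unfold is_zero_psi_G.
  assert (Hp : ~ nonpos_int (RtoC x) <-> no_pole (x - 1)).
  { split.
    - intros H m E; apply H; exists m; f_equal; rewrite S_INR in E; lra.
    - intros H [m E]; apply RtoC_inj in E; apply (H m); rewrite S_INR; lra. }
  split; intros [H E]; apply Hp in H; (split; [try exact H; apply Hp, H|]).
  - rewrite psi_G_RtoC in E by exact H; apply RtoC_inj, E.
  - rewrite psi_G_RtoC, E by (apply Hp; exact H); reflexivity.
Qed.

Theorem mainTheorem8
  (beta : nat -> R)
  (beta_decr : forall k : nat, beta (S k) < beta k)
  (beta_zeros : forall z : C,
     is_zero_psi_G z <-> exists k : nat, z = RtoC (beta k)) :
  let L := ln (2 * PI) in
  let g := euler_gamma in
  is_series (fun k : nat => 1 / beta k ^ 4)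
    (2 * zeta 3 * (L + 1) + g ^ 4 + PI ^ 4 / 9
     + 1 / 6 * PI ^ 2 * (L ^ 2 + 3) + 2 * g ^ 3 * (L + 1)
     + 1 / 6 * g * (24 * zeta 3 + 3 + 4 * PI ^ 2 * (L + 1)
                    + 3 * L * (L ^ 2 - L + 7))
     + 1 / 6 * g ^ 2 * (9 * L ^ 2 + 6 * L + 4 * PI ^ 2 + 21)
     + 1 / 16 * (L ^ 4 - 4 * L ^ 3 + 22 * L ^ 2 - 36 * L + 49)).
Proof.
  intros L g.
  pose proof euler_gamma_bounds as Hg; pose proof ln_2PI_bounds as HL.
  fold g in Hg; fold L in HL.
  set (a := (L - 1) / 2); set (b := 1 + g).
  set (rho := fun k => epsilon (inhabits 0) (is_root_in a b ones k)).
  assert (Hrho : forall k, is_root_in a b ones k (rho k)).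
  { intros k; unfold rho; apply epsilon_spec, wpsi_root; try reflexivity;
      [apply ones_weight|unfold a; lra|unfold a, b; lra|unfold b; lra]. }
  assert (Hbeta : forall x, no_pole (x - 1) /\ wpsi a b ones (x - 1) = 0 <->
                    exists k, x = beta k).
  { intros x; split.
    - intros H; apply is_zero_psi_G_RtoC, beta_zeros in H.
      destruct H as [k E]; exists k; apply RtoC_inj, E.
    - intros [k E]; apply is_zero_psi_G_RtoC, beta_zeros; exists k; f_equal; exact E. }
  (* Both sequences are decreasing enumerations of the same set of real zeros. *)
  assert (Heq : forall k, beta k = rho k + 1).
  { apply (decreasing_enum_unique beta (fun k => rho k + 1)); [exact beta_decr| | |].
    - intros k; pose proof (root_intervals_ordered rho k (S k)
        ltac:(intros; apply Hrho) ltac:(lia)); lra.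
    - intros k; destruct (proj2 (Hbeta (beta k)) ltac:(eauto)) as [Hp E].
      destruct (wpsi_zero_located a b ones (beta k - 1)) as [m Hm];
        auto using ones_weight; try (unfold a, b; lra).
      exists m; rewrite <- (is_root_in_unique a b ones m _ _ (Hrho m) Hm E); ring.
    - intros k; apply Hbeta.
      replace (rho k + 1 - 1) with (rho k) by ring.
      destruct (Hrho k) as [Hi [E _]]; split; [|exact E].
      apply (root_interval_no_pole k), Hi. }
  assert (Ext : forall k, (/ (rho k + 1)) ^ 4 = 1 / beta k ^ 4).
  { intros k; rewrite Heq, pow_inv; unfold Rdiv; ring. }
  apply (is_series_ext _ _ _ Ext).
  pose proof (wpsi_root_series a b rho ltac:(unfold a; lra)
    ltac:(unfold a, b; lra) ltac:(unfold b; lra) Hrho) as S.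
  cbv zeta in S; rewrite <- zeta_3 in S.
  (* Here [a1 = gamma + (L - 1) / 2] and [a2 = - (1 + gamma) - PI^2 / 6], so a polynomial identity
     remains; for instance [PI^4 / 9] collects [1/90 + 2/36 + 4/90]. *)
  match type of S with is_series _ ?v => match goal with |- is_series _ ?t =>
    replace t with v; [exact S|unfold a, b; field] end end.
Qed.
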